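(* Let $f : A \to B$ be a quasi-isomorphism of CDG rings. Assume that $B$ admits a divided power structure. Then there exist a CDG ring $\tilde{B}$ and CDG ring homomorphisms $e : A \to \tilde{B}$, $p : \tilde{B} \to A$ and $\tilde{f} : \tilde{B} \to B$, such that $p \circ e = \operatorname{id}_A$, $\tilde{f} \circ e = f$, and $\tilde{f}$ is a surjective quasi-isomorphism.
   Context: A commutative graded ring is a nonpositively graded (associative, unital) ring $A = \bigoplus_{i \leq 0} A^i$ satisfying the strong commutativity conditions: $b \cdot a = (-1)^{i j} \, a \cdot b$ for all $a \in A^i$, $b \in A^j$, and $a \cdot a = 0$ for all $a \in A^i$ with $i$ odd. A commutative differential graded ring (CDG ring) is a commutative graded ring $A$ equipped with an additive differential $\mathrm{d}_A$ of degree $+1$ such that $\mathrm{d}_A \circ \mathrm{d}_A = 0$ and $\mathrm{d}_A(a \cdot b) = \mathrm{d}_A(a) \cdot b + (-1)^i \, a \cdot \mathrm{d}_A(b)$ for all $a \in A^i$, $b \in A^j$. A CDG ring homomorphism is a degree-preserving unital ring homomorphism that commutes with the differentials. A quasi-isomorphism of CDG rings is a CDG ring homomorphism $f : A \to B$ such that $\mathrm{H}(f) : \mathrm{H}(A) \to \mathrm{H}(B)$ is bijective, where $\mathrm{H}(A) = \bigoplus_{i \leq 0} \mathrm{H}^i(A)$ is the cohomology. A divided power structure (PD structure) on a CDG ring $A$ consists of functions $\gamma^k : A^i \to A^{k i}$, for all integers $k \geq 0$ and all even $i \leq -2$, satisfying: (PD1) For all even $i \leq -2$, all $a \in A^i$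 and all $k, l \geq 0$: $\gamma^0(a) = 1$, $\gamma^1(a) = a$, and $\gamma^k(a) \cdot \gamma^l(a) = \binom{k+l}{l} \, \gamma^{k+l}(a)$. (PD2) For all even $i \leq -2$, all $a \in A^i$ and all $k \geq 1$: $\mathrm{d}_A(\gamma^k(a)) = \mathrm{d}_A(a) \cdot \gamma^{k-1}(a)$. Together with the remaining standard divided power axioms: $\gamma^k(a + b) = \sum_{l=0}^{k} \gamma^l(a) \cdot \gamma^{k-l}(b)$ for $a, b \in A^i$ with $i \leq -2$ even and $k \geq 0$; $\gamma^k(a \cdot b) = a^k \cdot \gamma^k(b)$ for $a \in A^j$ with $j \leq 0$ even, $b \in A^i$ with $i \leq -2$ even and $k \geq 0$; $\gamma^k(a \cdot b) = 0$ for $a, b$ homogeneous of odd degrees and $k \geq 2$; and $\gamma^k(\gamma^l(a)) = \frac{(kl)!}{k! \, (l!)^k} \, \gamma^{kl}(a)$ for $a \in A^i$ with $i \leq -2$ even, $k \geq 0$ and $l \geq 1$. *)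

(* Defs.v *)
From HB Require Import structures.
From mathcomp Require Import all_boot all_order all_algebra.
From mathcomp Require Import boolp.

Set Implicit Arguments.
Unset Strict Implicit.
Unset Printing Implicit Defensive.

Import Order.TTheory GRing.Theory Num.Theory.
Local Open Scope ring_scope.
Local Open Scope quotient_scope.

(* The grading is internal: [homog i a] means that [a] lies in the component
   A^i of the ring A, a subgroup of the total ring. Components of positive
   degree vanish, so [homog_span] and [homog_direct] say that
   A = (+)_(k : nat) A^(-k). The base is a pzRingType, so the zero ring is
   allowed. *)
HB.mixin Record PzRing_isCommGraded A of GRing.PzRing A := {
  homog : int -> A -> Prop;
  homog_0 : forall (i : int), homog i 0;
  homog_sub : forall (i : int) (a b : A),
    homog i a -> homog i b -> homog i (a - b);
  homog_pos : forall (i : int) (a : A), 0 < i -> homog i a -> a = 0;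
  homog_span : forall (a : A), exists (n : nat) (c : nat -> A),
    (forall k, homog (- k%:Z) (c k)) /\ a = \sum_(k < n) c k;
  homog_direct : forall (n : nat) (c : nat -> A),
    (forall k, homog (- k%:Z) (c k)) -> \sum_(k < n) c k = 0 ->
    forall k, (k < n)%N -> c k = 0;
  homog_1 : homog 0 1;
  homog_mul : forall (i j : int) (a b : A),
    homog i a -> homog j b -> homog (i + j) (a * b);
  gcommutative : forall (i j : int) (a b : A), homog i a -> homog j b ->
    b * a = (-1) ^+ (`|i| * `|j|)%N * (a * b);
  odd_square0 : forall (i : int) (a : A), odd `|i|%N -> homog i a -> a * a = 0
}.

#[short(type="commGradedRingType")]
HB.structure Definition CommGradedRing :=
  {A of GRing.PzRing A & PzRing_isCommGraded A}.

HB.mixin Record CommGraded_isCDG A of CommGradedRing A := {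
  cdg_d : A -> A;
  cdg_dD : {morph cdg_d : a b / a + b};
  cdg_d_deg : forall (i : int) (a : A), homog i a -> homog (i + 1) (cdg_d a);
  cdg_dd : forall (a : A), cdg_d (cdg_d a) = 0;
  cdg_leibniz : forall (i j : int) (a b : A), homog i a -> homog j b ->
    cdg_d (a * b) = cdg_d a * b + (-1) ^+ `|i|%N * (a * cdg_d b)
}.

#[short(type="cdgRingType")]
HB.structure Definition CDGRing := {A of CommGradedRing A & CommGraded_isCDG A}.

Record cdgHom (A B : cdgRingType) := CDGHom {
  cdg_fun :> {rmorphism A -> B};
  cdg_fun_deg : forall (i : int) (a : A), homog i a -> homog i (cdg_fun a);
  cdg_fun_d : forall (a : A), cdg_fun (cdg_d a) = cdg_d (cdg_fun a)
}.

Section Cohomology.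
Variable A : cdgRingType.

Lemma cdg_d0 : cdg_d (0 : A) = 0.
Proof. by apply: (addrI (cdg_d 0)); rewrite -cdg_dD !addr0. Qed.

Lemma cdg_dB : {morph @cdg_d A : a b / a - b}.
Proof.
move=> a b; apply: (addIr (cdg_d b)).
by rewrite -cdg_dD !subrK.
Qed.

Definition cocycle : {pred A} := [pred a | cdg_d a == 0].

Lemma cocycle_zmod_closed : zmod_closed cocycle.
Proof.
split; first by rewrite inE cdg_d0.
by move=> a b; rewrite !inE cdg_dB => /eqP-> /eqP->; rewrite subr0.
Qed.

HB.instance Definition _ :=
  GRing.isZmodClosed.Build A cocycle cocycle_zmod_closed.

Record cocycles := Cocycle { cocycle_val :> A; _ : cocycle_val \in cocycle }.

HB.instance Definition _ := [isSub for cocycle_val].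
HB.instance Definition _ := [Choice of cocycles by <:].
HB.instance Definition _ := [SubChoice_isSubZmodule of cocycles by <:].

Definition coboundary : {pred cocycles} :=
  [pred z : cocycles | `[< exists a : A, \val z = cdg_d a >]].

Lemma coboundary_zmod_closed : zmod_closed coboundary.
Proof.
split; first by apply/asboolP; exists 0; rewrite cdg_d0.
move=> y z /asboolP[a ya] /asboolP[b zb]; apply/asboolP.
by exists (a - b); rewrite raddfB cdg_dB /= ya zb.
Qed.

HB.instance Definition _ :=
  GRing.isZmodClosed.Build cocycles coboundary coboundary_zmod_closed.

(* H(A) is the total cohomology Ker d / Im d; as d is homogeneous, this is the
   direct sum of the H^i(A). *)
Definition cohomology := {ideal_quot coboundary}.
HB.instance Definition _ := GRing.Zmodule.on cohomology.

End Cohomology.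

Section CohomologyMap.
Variables (A B : cdgRingType) (f : cdgHom A B).

Lemma cocycle_map_subproof (z : cocycles A) : f (\val z) \in @cocycle B.
Proof.
by case: z => a /= /eqP da; rewrite inE -cdg_fun_d da raddf0.
Qed.

Definition cocycle_map (z : cocycles A) : cocycles B :=
  Cocycle (cocycle_map_subproof z).

Definition cohomology_map (x : cohomology A) : cohomology B :=
  \pi_(cohomology B) (cocycle_map (repr x)).

Lemma cohomology_map_pi (z : cocycles A) :
  cohomology_map (\pi_(cohomology A) z) = \pi_(cohomology B) (cocycle_map z).
Proof.
have /asboolP[a ha] : repr (\pi_(cohomology A) z) - z \in @coboundary A.
  by rewrite Quotient.idealrBE reprK.
apply/eqP; rewrite -Quotient.idealrBE; apply/asboolP; exists (f a).
by rewrite -cdg_fun_d -ha !raddfB.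
Qed.

Definition quasi_iso : Prop := bijective cohomology_map.

End CohomologyMap.

Definition pd_degree (i : int) : Prop := (~~ odd `|i|%N) /\ i <= - 2%:Z.

(* [pd_gamma i k] represents gamma^k : B^i -> B^(k i); only its values on B^i
   for [pd_degree i] are meaningful. *)
Record pdStructure (B : cdgRingType) := PDStructure {
  pd_gamma : int -> nat -> B -> B;
  pd_gamma_deg : forall (i : int) (k : nat) (a : B), pd_degree i -> homog i a ->
    homog (k%:Z * i) (pd_gamma i k a);
  pd_gamma0 : forall (i : int) (a : B),
    pd_degree i -> homog i a -> pd_gamma i 0 a = 1;
  pd_gamma1 : forall (i : int) (a : B),
    pd_degree i -> homog i a -> pd_gamma i 1 a = a;
  pd_gammaM : forall (i : int) (k l : nat) (a : B), pd_degree i -> homog i a ->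
    pd_gamma i k a * pd_gamma i l a = pd_gamma i (k + l) a *+ 'C(k + l, l);
  pd_gamma_d : forall (i : int) (k : nat) (a : B),
    pd_degree i -> homog i a -> (1 <= k)%N ->
    cdg_d (pd_gamma i k a) = cdg_d a * pd_gamma i k.-1 a;
  pd_gammaD : forall (i : int) (k : nat) (a b : B),
    pd_degree i -> homog i a -> homog i b ->
    pd_gamma i k (a + b) =
      \sum_(0 <= l < k.+1) pd_gamma i l a * pd_gamma i (k - l) b;
  pd_gamma_even : forall (i j : int) (k : nat) (a b : B),
    ~~ odd `|j|%N -> j <= 0 -> homog j a ->
    pd_degree i -> homog i b ->
    pd_gamma (j + i) k (a * b) = a ^+ k * pd_gamma i k b;
  pd_gamma_odd : forall (i j : int) (k : nat) (a b : B),
    odd `|i|%N -> i <= 0 -> homog i a ->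
    odd `|j|%N -> j <= 0 -> homog j b -> (2 <= k)%N ->
    pd_gamma (i + j) k (a * b) = 0;
  pd_gamma_comp : forall (i : int) (k l : nat) (a : B),
    pd_degree i -> homog i a -> (1 <= l)%N ->
    pd_gamma (l%:Z * i) k (pd_gamma i l a) =
      pd_gamma i (k * l) a *+ ((k * l)`! %/ (k`! * l`! ^ k))
}.

(* Main.v *)
Require Import Defs.
From HB Require Import structures.
From mathcomp Require Import all_boot all_order all_algebra.
From mathcomp Require Import boolp.
From mathcomp Require Import zify.

(** Adjoin to [A], for every homogeneous element b of [B] of negative degree, a
    variable x_b together with its differential dx_b, and send x_b to b. The
    resulting CDG ring [Bt] retracts onto [A] by killing the variables. It
    surjects onto [B]: in negative degrees by construction, and in degree 0
    because every element there is a cocycle, hence of the form f(a) + d(b')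
    as f is surjective in cohomology, and d(b') is in the image.

    The point is to adjoin x_b and dx_b without changing the cohomology. If
    x = x_b has odd degree, the exterior variable x and the polynomial variable
    y = dx do this over the integers, as d(x y^k) = y^(k+1). If x has even
    degree, d(x^k) = k x^(k-1) dx is not divisible enough, and x has to be
    adjoined with divided powers, for which d(gamma^(k+1) x) = dx gamma^k(x).
    The divided power structure on [B] is what allows the map to [B] to be
    defined on these: gamma^k(x_b) goes to gamma^k(b).

    Both kinds of variable are adjoined in two steps that kill a given cocycle
    t: [exterior] adjoins an odd u with d u = t, and [finite_seq] adjoins an
    even variable with ordinary or divided powers e_k, and d e_(k+1) = t e_k. Then
    [contractible_extension] adjoins one pair (x, dx) and writes every cocycle
    as its augmentation plus a coboundary, by an explicit formula.

    The infinitely many variables are adjoined at once by the universal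
    construction [free_cdg]: formal expressions modulo the identities that hold
    in all CDG rings over [A] with a choice of values for the variables. The
    axioms are themselves such identities (or, for the grading, follow from
    componentwise ones), so they need no computation with monomials.
    Contractibility is proved one variable at a time ([kill_generator]): mapping
    one variable x_b of F = [free_cdg] to the new variable of F<x, dx>
    and all others to themselves gives a section of the map F<x, dx> -> F that
    sends x to x_b. The contraction of F<x, dx> therefore shows that a cocycle
    of F is cohomologous to the same expression with x_b killed. An expression
    involves finitely many variables, so after finitely many steps it comes
    from [A] ([free_retraction]). *)

Set Implicit Arguments.
Unset Strict Implicit.
Unset Printing Implicit Defensive.

Import Order.TTheory GRing.Theory Num.Theory.
Local Open Scope ring_scope.
Local Open Scope quotient_scope.

(** * Degrees and the sign involution *)

Arguments homog_pos {s} [i a].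
Arguments homog_sub {s} [i a b].
Arguments homog_mul {s} [i j a b].
Arguments homog_direct {s} [n c].
Arguments gcommutative {s} [i j a b].
Arguments odd_square0 {s} [i a].
Arguments cdg_d_deg {s} [i a].
Arguments cdg_leibniz {s} [i j a b].

Definition zodd (i : int) : bool := odd `|i|%N.

Lemma zoddD i j : zodd (i + j) = zodd i (+) zodd j.
Proof. rewrite /zodd; lia. Qed.

Lemma zoddN i : zodd (- i) = zodd i.
Proof. by rewrite /zodd abszN. Qed.

Lemma zoddMn (k : nat) i : zodd (k%:Z * i) = odd k && zodd i.
Proof. by rewrite /zodd abszM oddM. Qed.

Lemma sum_widen (V : nmodType) (F : nat -> V) n N :
  (n <= N)%N -> (forall k, (n <= k)%N -> F k = 0) ->
  \sum_(k < n) F k = \sum_(k < N) F k.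
Proof.
move=> leNM F0; rewrite -!(big_mkord xpredT F).
rewrite [RHS](@big_cat_nat _ _ _ n) //= [X in _ + X]big_nat.
by rewrite [X in _ + X]big1 ?addr0 // => k /andP[/F0].
Qed.

Lemma morphB0 (U V : zmodType) (F : U -> V) :
  {morph F : a b / a - b} -> F 0 = 0.
Proof. by move=> FB; rewrite -[X in F X](subrr 0) FB subrr. Qed.

Lemma morphBD (U V : zmodType) (F : U -> V) :
  {morph F : a b / a - b} -> {morph F : a b / a + b}.
Proof.
move=> FB a b; have FN : F (- b) = - F b.
  by rewrite -sub0r FB (morphB0 FB) sub0r.
by rewrite -[b in LHS]opprK FB FN opprK.
Qed.

(** The existence of a decomposition into homogeneous components is proved for
    each new ring before that ring carries a grading; this section collects the
    closure properties, for a family [H] of candidate components. *)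
Section Span.
Variables (P : pzRingType) (H : int -> P -> Prop).
Hypothesis H0 : forall i, H i 0.
Hypothesis HB : forall i a b, H i a -> H i b -> H i (a - b).
Hypothesis Hpos : forall (i : int) a, 0 < i -> H i a -> a = 0.

Definition spanned (a : P) : Prop := exists (n : nat) (c : nat -> P),
  (forall k, H (- k%:Z) (c k)) /\ a = \sum_(k < n) c k.

Lemma spanned_trunc a : spanned a -> exists (n : nat) (c : nat -> P),
  [/\ forall k, H (- k%:Z) (c k), forall k, (n <= k)%N -> c k = 0
    & a = \sum_(k < n) c k].
Proof.
move=> [n [c [Hc ->]]]; exists n, (fun k => if (k < n)%N then c k else 0).
split=> [k|k|]; first by case: ifP.
  by rewrite leqNgt; case: ifP.
by apply: eq_bigr => k _; rewrite ltn_ord.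
Qed.

Lemma closed_add i a b : H i a -> H i b -> H i (a + b).
Proof.
by move=> Ha Hb; rewrite -[b]opprK -[- b]sub0r; apply: HB => //; apply: HB.
Qed.

Lemma spanned0 : spanned 0.
Proof. by exists 0%N, (fun=> 0); split=> //; rewrite big_ord0. Qed.

Lemma spanned_add a b : spanned a -> spanned b -> spanned (a + b).
Proof.
move=> /spanned_trunc[n [c [Hc c0 ->]]] /spanned_trunc[m [c' [Hc' c0' ->]]].
exists (maxn n m), (fun k => c k + c' k); split.
  by move=> k; apply: closed_add.
rewrite big_split /=.
by congr (_ + _); apply: sum_widen; rewrite ?leq_maxl ?leq_maxr.
Qed.

Lemma spanned_homog i a : H i a -> spanned a.
Proof.
have [i_gt0|i_le0] := ltrP 0 i; first by move/(Hpos i_gt0)->; exact: spanned0.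
move=> Ha; exists `|i|%N.+1, (fun k => if k == `|i|%N then a else 0); split.
  move=> k; case: eqP => // ->.
  by have -> : - `|i|%N%:Z = i by lia.
by rewrite big_ord_recr /= eqxx big1 ?add0r // => k _; rewrite ltn_eqF.
Qed.

Lemma spanned_sum (I : Type) (r : seq I) (F : I -> P) :
  (forall k, spanned (F k)) -> spanned (\sum_(k <- r) F k).
Proof. by move=> HF; elim/big_ind: _; [exact: spanned0|exact: spanned_add|]. Qed.

Lemma spanned_mul a b : (forall i j a b, H i a -> H j b -> H (i + j) (a * b)) ->
  spanned a -> spanned b -> spanned (a * b).
Proof.
move=> HM [n [c [Hc ->]]] [m [c' [Hc' ->]]]; rewrite mulr_suml.
apply: spanned_sum => k; rewrite mulr_sumr; apply: spanned_sum => l.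
exact: spanned_homog (HM _ _ _ _ (Hc k) (Hc' l)).
Qed.

End Span.

Section GradedAdditive.
Variable R : commGradedRingType.
Implicit Types (a b : R) (i j : int).

Lemma homogD i a b : homog i a -> homog i b -> homog i (a + b).
Proof. exact: (closed_add (@homog_0 R) (@homog_sub R)). Qed.

Lemma homogN i a : homog i a -> homog i (- a).
Proof. by move=> Ha; rewrite -sub0r; apply: homog_sub => //; exact: homog_0. Qed.

Lemma homog_sum i (I : Type) (r : seq I) (F : I -> R) :
  (forall k, homog i (F k)) -> homog i (\sum_(k <- r) F k).
Proof. by move=> HF; elim/big_ind: _; [exact: homog_0|exact: homogD|]. Qed.

Lemma homogMn i a n : homog i a -> homog i (a *+ n).
Proof.
move=> Ha; elim: n => [|n IHn]; first exact: homog_0.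
by rewrite mulrS; apply: homogD.
Qed.

Lemma homog_ind (Q : R -> Prop) :
  (forall a b, Q a -> Q b -> Q (a + b)) ->
  (forall i a, homog i a -> Q a) -> forall a, Q a.
Proof.
move=> QD Qh a; have [n [c [Hc ->]]] := homog_span a.
by elim/big_ind: _ => // [|k _]; [exact: Qh (homog_0 0)|exact: Qh (Hc k)].
Qed.

Variable w : nat -> R -> R.
Hypothesis w_sub : forall k, {morph w k : a b / a - b}.

(** As the grading is a property rather than a choice of components, maps that
    act on each degree separately are obtained by gluing: the decomposition of
    an element is unique, so applying [w k] to its component of degree - k is
    well defined and additive. *)
Lemma graded_additive : exists F : R -> R,
  {morph F : a b / a - b} /\ forall k a, homog (- k%:Z) a -> F a = w k a.
Proof.
have w0 k : w k 0 = 0 := morphB0 (w_sub k).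
pose comps a n (c : nat -> R) := [/\ forall k, homog (- k%:Z) (c k),
  forall k, (n <= k)%N -> c k = 0 & a = \sum_(k < n) c k].
have compsE a n m c c' : comps a n c -> comps a m c' ->
    \sum_(k < n) w k (c k) = \sum_(k < m) w k (c' k).
  move=> [Hc c0 ac] [Hc' c0' ac'].
  have [len lem] := (leq_maxl n m, leq_maxr n m).
  rewrite (sum_widen (F := fun k => w k (c k)) len) => [|k /c0->//].
  rewrite (sum_widen (F := fun k => w k (c' k)) lem) => [|k /c0'->//].
  apply: eq_bigr => k _; congr (w _ _); apply/eqP.
  rewrite -subr_eq0; apply/eqP.
  apply: (@homog_direct R (maxn n m) (fun k => c k - c' k)) => //.
    by move=> l; apply: homog_sub.
  by rewrite sumrB -(sum_widen len c0) -(sum_widen lem c0') -ac -ac' subrr.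
have dec a : {nc : nat * (nat -> R) | comps a nc.1 nc.2}.
  apply: cid; have [n [c Hc]] := spanned_trunc (@homog_0 R) (homog_span a).
  by exists (n, c).
pose F a := \sum_(k < (sval (dec a)).1) w k ((sval (dec a)).2 k).
have FE a n c : comps a n c -> F a = \sum_(k < n) w k (c k).
  exact: compsE (svalP (dec a)).
exists F; split=> [a b|k a Ha].
  have [Hc c0 ac] := svalP (dec a); have [Hc' c0' bc] := svalP (dec b).
  move: (sval (dec a)) (sval (dec b)) Hc c0 ac Hc' c0' bc.
  move=> [n c] [m c'] /= Hc c0 ac Hc' c0' bc.
  have [len lem] := (leq_maxl n m, leq_maxr n m).
  rewrite (FE a n c) // (FE b m c') //.
  rewrite (FE _ (maxn n m) (fun k => c k - c' k)); last first.
    split=> [k|k|]; first exact: homog_sub.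
      by rewrite geq_max => /andP[/c0-> /c0'->]; rewrite subr0.
    by rewrite sumrB -(sum_widen len c0) -(sum_widen lem c0') -ac -bc.
  rewrite (sum_widen (F := fun k => w k (c k)) len) => [|k /c0->//].
  rewrite (sum_widen (F := fun k => w k (c' k)) lem) => [|k /c0'->//].
  by rewrite -sumrB; apply: eq_bigr => k _; rewrite w_sub.
rewrite (FE a k.+1 (fun l => if l == k then a else 0)).
  by rewrite big_ord_recr /= eqxx big1 ?add0r // => l _; rewrite ltn_eqF.
split=> [l|l|]; first by case: eqP => [->//|_]; exact: homog_0.
  by rewrite ltnNge; case: eqP => [->|//]; rewrite leqnn.
by rewrite big_ord_recr /= eqxx big1 ?add0r // => l _; rewrite ltn_eqF.
Qed.

End GradedAdditive.

(** Gluing the identity in degree [i] and zero elsewhere. *)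
Lemma component_ex (R : commGradedRingType) (i : int) : exists F : R -> R,
  [/\ {morph F : a b / a - b}, forall a, homog i a -> F a = a
    & forall j a, j != i -> homog j a -> F a = 0].
Proof.
have [|F [FB FE]] :=
  @graded_additive R (fun k a => if - k%:Z == i then a else 0).
  by move=> k a b /=; case: eqP; rewrite ?subr0.
have F0 := morphB0 FB.
have Fh j a : homog j a -> F a = if j == i then a else 0.
  have [j_gt0 /(homog_pos j_gt0)->|j_le0 Ha] := ltrP 0 j.
    by rewrite F0; case: eqP.
  have Ej : - `|j|%N%:Z = j by lia.
  by rewrite (FE `|j|%N) Ej.
exists F; split=> // [a /Fh|j a /negPf ij /Fh]; first by rewrite eqxx.
by rewrite ij.
Qed.

(** Independence of components also holds for a shifted range of degrees: a
    component of a graded extension is often a component of the base ring in a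
    degree shifted by the degree of a variable. *)
Lemma homog_inj_sum (R : commGradedRingType) (s : int) (n : nat)
    (c : nat -> R) :
  (forall k, homog (s - k%:Z) (c k)) -> \sum_(k < n) c k = 0 ->
  forall k, (k < n)%N -> c k = 0.
Proof.
move=> Hc c0 k kn; have [F [FB FE F0]] := component_ex R (s - k%:Z).
have F00 := morphB0 FB.
have : F (\sum_(k < n) c k) = 0 by rewrite c0.
rewrite (big_morph F (morphBD FB) F00) (bigD1 (Ordinal kn)) //= FE //.
rewrite big1 ?addr0 // => l.
rewrite -val_eqE /= => lk; apply: F0 (Hc l).
by apply: contra lk; rewrite (inj_eq (addrI _)) eqr_opp.
Qed.

(** The automorphism a |-> (-1)^|a| a. With it the Leibniz rule, and the
    commutation rule with a fixed odd element, become identities between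
    additive maps, which need not be restricted to homogeneous elements. *)
Lemma sign_ex (R : commGradedRingType) : exists F : R -> R,
  {morph F : a b / a - b} /\
  forall i a, homog i a -> F a = if zodd i then - a else a.
Proof.
have [|F [FB FE]] := @graded_additive R (fun k a => if odd k then - a else a).
  by move=> k a b; case: odd; rewrite // opprD.
exists F; split=> // i a.
have [i_gt0 /(homog_pos i_gt0)->|i_le0 Ha] := ltrP 0 i.
  by rewrite (morphB0 FB) oppr0; case: zodd.
have Ei : - `|i|%N%:Z = i by lia.
by rewrite (FE `|i|%N) ?Ei.
Qed.

Section Sign.
Variable R : commGradedRingType.
Implicit Types (a b : R) (i j : int).

Definition sign : R -> R := sval (cid (sign_ex R)).

Lemma sign_zmod_morphism : zmod_morphism sign.
Proof. by have [] := svalP (cid (sign_ex R)). Qed.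

HB.instance Definition _ :=
  GRing.isZmodMorphism.Build R R sign sign_zmod_morphism.

Lemma signE i a : homog i a -> sign a = if zodd i then - a else a.
Proof. have [_] := svalP (cid (sign_ex R)); exact. Qed.

Lemma sign_even i a : ~~ zodd i -> homog i a -> sign a = a.
Proof. by move=> /negPf ev /signE ->; rewrite ev. Qed.

Lemma sign_odd i a : zodd i -> homog i a -> sign a = - a.
Proof. by move=> od /signE ->; rewrite od. Qed.

Lemma signD : {morph sign : a b / a + b}. Proof. exact: raddfD. Qed.

Lemma signN : {morph sign : a / - a}. Proof. exact: raddfN. Qed.

Lemma sign0 : sign 0 = 0. Proof. exact: raddf0. Qed.

Lemma sign_monoid_morphism : monoid_morphism sign.
Proof.
split; first by rewrite (sign_even (i := 0)) //; exact: homog_1.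
move=> + b; apply: homog_ind => [a a' Ha Ha'|i a Ha].
  by rewrite mulrDl !signD Ha Ha' mulrDl.
move: b; apply: homog_ind => [b b' Hb Hb'|j b Hb].
  by rewrite mulrDr !signD Hb Hb' mulrDr.
rewrite (signE Ha) (signE Hb) (signE (homog_mul Ha Hb)) zoddD.
by case: (zodd i); case: (zodd j); rewrite /= ?mulNr ?mulrN ?opprK.
Qed.

HB.instance Definition _ :=
  GRing.isMonoidMorphism.Build R R sign sign_monoid_morphism.

Lemma sign1 : sign 1 = 1. Proof. by have [] := sign_monoid_morphism. Qed.

Lemma signM : {morph sign : a b / a * b}.
Proof. by have [] := sign_monoid_morphism. Qed.

Lemma signK : involutive sign.
Proof.
apply: homog_ind => [a b Ha Hb|i a Ha]; first by rewrite !signD Ha Hb.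
by rewrite (signE Ha); case: ifP => od; rewrite ?signN (signE Ha) od ?opprK.
Qed.

Lemma homog_sign i a : homog i a -> homog i (sign a).
Proof. by move=> Ha; rewrite (signE Ha); case: ifP => // _; apply: homogN. Qed.

Lemma gcommE i j a b : homog i a -> homog j b ->
  b * a = if zodd i && zodd j then - (a * b) else a * b.
Proof.
by move=> Ha Hb; rewrite (gcommutative Ha Hb) -signr_odd oddM mulr_sign.
Qed.

Lemma even_central i a b : ~~ zodd i -> homog i a -> a * b = b * a.
Proof.
move=> /negPf ev Ha; move: b; apply: homog_ind => [b b' Hb Hb'|j b Hb].
  by rewrite mulrDl mulrDr Hb Hb'.
by rewrite (gcommE Ha Hb) ev.
Qed.

Lemma odd_comm i a b : zodd i -> homog i a -> a * b = sign b * a.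
Proof.
move=> od Ha; move: b; apply: homog_ind => [b b' Hb Hb'|j b Hb].
  by rewrite signD mulrDl mulrDr Hb Hb'.
rewrite (signE Hb) (gcommE Hb Ha) od andbT; case: ifP => // _.
by rewrite mulNr.
Qed.

End Sign.

Section SignDiff.
Variable R : cdgRingType.
Implicit Types (a b : R) (i j : int).

HB.instance Definition _ :=
  GRing.isZmodMorphism.Build R R (@cdg_d R) (@cdg_dB R).

Lemma cdg_dN : {morph @cdg_d R : a / - a}. Proof. exact: raddfN. Qed.

Lemma cdg_d_sign a : cdg_d (sign a) = - sign (cdg_d a).
Proof.
move: a; apply: homog_ind => [a b Ha Hb|i a Ha].
  by rewrite !(cdg_dD, signD) Ha Hb opprD.
rewrite (signE Ha) (signE (cdg_d_deg Ha)) zoddD.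
by case: zodd; rewrite //= ?(cdg_dN, signN) ?opprK.
Qed.

Lemma sign_cdg_d a : sign (cdg_d a) = - cdg_d (sign a).
Proof. by rewrite cdg_d_sign opprK. Qed.

Lemma cdg_dM a b : cdg_d (a * b) = cdg_d a * b + sign a * cdg_d b.
Proof.
move: a; apply: homog_ind => [a a' Ha Ha'|i a Ha].
  by rewrite mulrDl !(cdg_dD, signD) Ha Ha' !mulrDl addrACA.
move: b; apply: homog_ind => [b b' Hb Hb'|j b Hb].
  by rewrite mulrDr !(cdg_dD, signD) Hb Hb' !mulrDr addrACA.
rewrite (cdg_leibniz Ha Hb) (signE Ha) -signr_odd mulr_sign.
by rewrite /zodd; case: odd; rewrite ?mulNr.
Qed.

Lemma cdg_d1 : cdg_d (1 : R) = 0.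
Proof.
by apply: (@homog_pos R (0 + 1)) => //; apply: cdg_d_deg; exact: homog_1.
Qed.

End SignDiff.

(** * Homomorphisms of CDG rings *)

(** A homomorphism matters only through its values, so homomorphisms are
    constructed as existence statements that give the values. *)

Section BuildHom.
Variables (R S : cdgRingType) (f : R -> S).
Hypotheses (fB : zmod_morphism f) (fM : monoid_morphism f).
Hypothesis f_deg : forall i a, homog i a -> homog i (f a).
Hypothesis f_d : forall a, f (cdg_d a) = cdg_d (f a).

Lemma build_cdgHom : exists F : cdgHom R S, F =1 f.
Proof.
pose fa := GRing.isZmodMorphism.Build R S f fB.
pose fm := GRing.isMonoidMorphism.Build R S f fM.
pose F : {rmorphism R -> S} := HB.pack f fa fm.
by exists (@CDGHom R S F f_deg f_d).
Qed.

End BuildHom.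

Lemma cdgHom_id (R : cdgRingType) : exists F : cdgHom R R, F =1 id.
Proof. by apply: build_cdgHom. Qed.

Lemma cdgHom_comp (R S T : cdgRingType) (g : cdgHom S T) (f : cdgHom R S) :
  exists F : cdgHom R T, forall a, F a = g (f a).
Proof.
apply: (build_cdgHom (f := fun a => g (f a))).
- by move=> a b; rewrite !rmorphB.
- by split=> [|a b]; rewrite ?rmorph1 ?rmorphM.
- by move=> i a Ha; do 2!apply: cdg_fun_deg.
- by move=> a; rewrite !cdg_fun_d.
Qed.

Lemma cdgHom_sign (R S : cdgRingType) (f : cdgHom R S) a :
  f (sign a) = sign (f a).
Proof.
move: a; apply: homog_ind => [a b Ha Hb|i a Ha].
  by rewrite signD !(rmorphD f) signD Ha Hb.
by rewrite (signE Ha) (signE (cdg_fun_deg f Ha)); case: ifP; rewrite ?rmorphN.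
Qed.

(** * Adjoining an odd variable that kills an even cocycle *)

(** The variable u of degree [od_deg] to be adjoined, and the cocycle
    [od_t] that is to become d u. *)
Record odd_datum (R : cdgRingType) := OddDatum {
  od_deg : int;
  od_odd : zodd od_deg;
  od_neg : od_deg < 0;
  od_t : R;
  od_t_deg : homog (od_deg + 1) od_t;
  od_dt : cdg_d od_t = 0
}.

(** The pair (a, b) stands for a + b u. *)
Definition exterior (R : cdgRingType) (D : odd_datum R) : Type := (R * R)%type.

Section Exterior.
Variables (R : cdgRingType) (D : odd_datum R).
Local Notation n := (od_deg D).
Local Notation t := (od_t D).

Local Notation ext := (exterior D).
HB.instance Definition _ := GRing.Zmodule.copy ext (R * R)%type.
Implicit Types x y z : ext.

Lemma ext_eq x y : x.1 = y.1 -> x.2 = y.2 -> x = y.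
Proof. by case: x y => [? ?] [? ?] /= -> ->. Qed.

(** (a + b u) (a' + b' u), where u a' = sign a' u and u u = 0. *)
Definition ext_mul x y : ext := (x.1 * y.1, x.1 * y.2 + x.2 * sign y.1).
Definition ext_one : ext := (1, 0).

Lemma ext_mulA : associative ext_mul.
Proof.
move=> x y z; apply: ext_eq => /=; first by rewrite mulrA.
by rewrite mulrDr mulrDl signM !mulrA addrA.
Qed.

Lemma ext_mul1l : left_id ext_one ext_mul.
Proof. by move=> x; apply: ext_eq; rewrite /= ?mul0r ?addr0 mul1r. Qed.

Lemma ext_mul1r : right_id ext_one ext_mul.
Proof. by move=> x; apply: ext_eq; rewrite /= ?mulr0 ?sign1 ?add0r mulr1. Qed.

Lemma ext_mulDl : left_distributive ext_mul +%R.
Proof.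
move=> x y z; apply: ext_eq; rewrite /= ?mulrDl //.
by rewrite addrACA.
Qed.

Lemma ext_mulDr : right_distributive ext_mul +%R.
Proof.
move=> x y z; apply: ext_eq; rewrite /= ?signD ?mulrDr //.
by rewrite addrACA.
Qed.

HB.instance Definition _ := GRing.Zmodule_isPzRing.Build ext
  ext_mulA ext_mul1l ext_mul1r ext_mulDl ext_mulDr.

Definition ext_homog i x := homog i x.1 /\ homog (i - n) x.2.

Lemma ext_homog0 i : ext_homog i 0.
Proof. by split; exact: homog_0. Qed.

Lemma ext_homogB i x y : ext_homog i x -> ext_homog i y -> ext_homog i (x - y).
Proof. by move=> [? ?] [? ?]; split; apply: homog_sub. Qed.

Lemma ext_homog_pos (i : int) x : 0 < i -> ext_homog i x -> x = 0.
Proof.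
move=> i_gt0 [Hx1 Hx2]; apply: ext_eq => /=; first exact: homog_pos Hx1.
by apply: homog_pos Hx2; have := od_neg D; lia.
Qed.

Lemma ext_span x : spanned ext_homog x.
Proof.
have -> : x = (x.1, 0) + (0, x.2) by apply: ext_eq; rewrite /= ?addr0 ?add0r.
apply: (spanned_add ext_homog0 ext_homogB).
- move: x.1; apply: homog_ind => [a b Ha Hb|i a Ha].
    have -> : ((a + b, 0) : ext) = (a, 0) + (b, 0).
      by apply: ext_eq; rewrite /= ?addr0.
    exact: (spanned_add ext_homog0 ext_homogB).
  apply: (spanned_homog ext_homog0 ext_homog_pos (i := i)).
  by split=> //; exact: homog_0.
- move: x.2; apply: homog_ind => [a b Ha Hb|i a Ha].
    have -> : ((0, a + b) : ext) = (0, a) + (0, b).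
      by apply: ext_eq; rewrite /= ?addr0.
    exact: (spanned_add ext_homog0 ext_homogB).
  apply: (spanned_homog ext_homog0 ext_homog_pos (i := i + n)).
  by split; rewrite /= ?addrK //; exact: homog_0.
Qed.

Lemma ext_direct (N : nat) (c : nat -> ext) :
  (forall k, ext_homog (- k%:Z) (c k)) -> \sum_(k < N) c k = 0 ->
  forall k, (k < N)%N -> c k = 0.
Proof.
move=> Hc c0 k kN.
have fstE : (\sum_(k < N) c k).1 = \sum_(k < N) (c k).1.
  by apply: (big_morph (fun x : ext => x.1)).
have sndE : (\sum_(k < N) c k).2 = \sum_(k < N) (c k).2.
  by apply: (big_morph (fun x : ext => x.2)).
apply: ext_eq => /=.
  apply: (homog_inj_sum (s := 0) (c := fun k => (c k).1)) kN => [l|].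
    by rewrite sub0r; have [] := Hc l.
  by rewrite -fstE c0.
apply: (homog_inj_sum (s := - n) (c := fun k => (c k).2)) kN => [l|].
  by rewrite addrC; have [] := Hc l.
by rewrite -sndE c0.
Qed.

Lemma ext_homog1 : ext_homog 0 1.
Proof. by split; [exact: homog_1|exact: homog_0]. Qed.

Lemma ext_homogM i j x y :
  ext_homog i x -> ext_homog j y -> ext_homog (i + j) (x * y).
Proof.
move=> [Hx1 Hx2] [Hy1 Hy2]; split; first exact: homog_mul.
apply: homogD; first by rewrite -addrA; apply: homog_mul.
by rewrite addrAC; apply: homog_mul => //; apply: homog_sign.
Qed.

Lemma ext_gcomm i j x y : ext_homog i x -> ext_homog j y ->
  y * x = (-1) ^+ (`|i| * `|j|)%N * (x * y).
Proof.
move=> [Hx1 Hx2] [Hy1 Hy2]; rewrite -signr_odd oddM mulr_sign.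
rewrite -/(zodd i) -/(zodd j).
have nO : zodd n by exact: od_odd.
have E2 : (y * x).2 = y.1 * x.2 + y.2 * sign x.1 by [].
have E2' : (x * y).2 = x.1 * y.2 + x.2 * sign y.1 by [].
apply: ext_eq.
  transitivity (y.1 * x.1) => //; rewrite (gcommE Hx1 Hy1).
  by case: ifP.
transitivity (if zodd i && zodd j then - (x * y).2 else (x * y).2); last first.
  by case: ifP.
rewrite E2 E2' (signE Hx1) (signE Hy1) (gcommE Hx2 Hy1) addrC.
rewrite zoddD zoddN nO.
case: (boolP (zodd i)) => iO; case: (boolP (zodd j)) => jO /=.
- by rewrite mulrN (gcommE Hx1 Hy2) iO zoddD zoddN nO jO /= mulrN opprD opprK.
- by rewrite mulrN (gcommE Hx1 Hy2) iO zoddD zoddN nO (negPf jO) /= opprK.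
- by rewrite (gcommE Hx1 Hy2) (negPf iO) /= mulrN.
- by rewrite (gcommE Hx1 Hy2) (negPf iO) /=.
Qed.

Lemma ext_sq0 i x : odd `|i|%N -> ext_homog i x -> x * x = 0.
Proof.
rewrite -/(zodd i) => iO [Hx1 Hx2]; apply: ext_eq.
  exact: odd_square0 iO Hx1.
transitivity (x.1 * x.2 + x.2 * sign x.1) => //.
rewrite (sign_odd iO Hx1) mulrN -(even_central _ _ Hx2) ?subrr //.
by rewrite zoddD zoddN iO od_odd.
Qed.

HB.instance Definition _ := PzRing_isCommGraded.Build ext
  ext_homog0 ext_homogB ext_homog_pos ext_span ext_direct ext_homog1
  ext_homogM ext_gcomm ext_sq0.

Definition ext_d x : ext := (cdg_d x.1 + sign x.2 * t, cdg_d x.2).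

Lemma ext_dD : {morph ext_d : x y / x + y}.
Proof.
move=> x y; apply: ext_eq; rewrite /= ?cdg_dD // signD mulrDl.
by rewrite addrACA.
Qed.

Lemma ext_d_deg i x : homog i x -> homog (i + 1) (ext_d x).
Proof.
move=> [Hx1 Hx2]; split=> /=; last by rewrite addrAC; apply: cdg_d_deg.
apply: homogD; first exact: cdg_d_deg.
have -> : i + 1 = (i - n) + (n + 1) by lia.
by apply: homog_mul (homog_sign Hx2) (od_t_deg D).
Qed.

Lemma t_even : ~~ zodd (n + 1).
Proof. by rewrite zoddD od_odd. Qed.

Lemma ext_dd x : ext_d (ext_d x) = 0.
Proof.
apply: ext_eq; rewrite /= ?cdg_dd // cdg_dD cdg_dd add0r cdg_dM od_dt mulr0.
by rewrite addr0 cdg_d_sign mulNr addNr.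
Qed.

Lemma ext_leibniz i j x y : homog i x -> homog j y ->
  ext_d (x * y) = ext_d x * y + (-1) ^+ `|i|%N * (x * ext_d y).
Proof.
move=> [Hx1 Hx2] _; rewrite -signr_odd mulr_sign -/(zodd i).
have tC a : t * a = a * t by exact: even_central t_even (od_t_deg D).
have s1 := signE Hx1; have s2 := signE Hx2.
move: s2; rewrite zoddD zoddN od_odd addbT => s2.
have -> : (if zodd i then - (x * ext_d y) else x * ext_d y)
        = ((sign x.1, - sign x.2) : ext) * ext_d y.
  rewrite s1 s2; case: (zodd i) => /=; last first.
    by rewrite opprK; case: x {Hx1 Hx2 s1 s2}.
  by rewrite -mulNr; congr (_ * _).
apply: ext_eq => /=.
  rewrite cdg_dM signD !signM signK !mulrDl mulrDr.
  rewrite -[sign x.2 * t * y.1]mulrA tC !mulrA.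
  by rewrite !addrA [RHS](ACl (1*3*4*2)).
rewrite cdg_dD !cdg_dM !signD !signM signK cdg_d_sign.
rewrite (sign_even t_even (od_t_deg D)) mulNr mulrDr opprD !mulrDl !addrA.
rewrite sign_cdg_d !mulrN opprK -(mulrA _ t) tC.
by rewrite [RHS](ACl (1*4*3*5*(2*6))) /= subrr addr0.
Qed.

HB.instance Definition _ := CommGraded_isCDG.Build ext
  ext_dD ext_d_deg ext_dd ext_leibniz.

Lemma ext_signE x : sign x = (sign x.1, - sign x.2) :> ext.
Proof.
elim/homog_ind: x => [x y Hx Hy|i x Hx].
  by rewrite signD Hx Hy; apply: ext_eq; rewrite /= ?signD ?opprD.
have [Hx1 Hx2] := Hx; rewrite (signE Hx) (signE Hx1) (signE Hx2).
rewrite zoddD zoddN od_odd addbT; apply: ext_eq => /=.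
  by case: ifP.
by case: (zodd i); rewrite /= ?opprK.
Qed.

Definition ext_const (a : R) : ext := (a, 0).
Definition ext_var : ext := (0, 1).

Lemma ext_const_hom : exists F : cdgHom R ext, F =1 ext_const.
Proof.
apply: build_cdgHom.
- by move=> a b; apply: ext_eq; rewrite /= ?subr0.
- split=> // a b; apply: ext_eq => //=.
  transitivity (a * 0 + 0 * sign b) => //.
  by rewrite mulr0 mul0r addr0.
- by move=> i a Ha; split=> //; exact: homog_0.
- move=> a; apply: ext_eq => //=; last by rewrite cdg_d0.
  by rewrite sign0 mul0r addr0.
Qed.

Lemma ext_mul_var x : x * ext_var = (0, x.1).
Proof.
apply: ext_eq; first exact: mulr0.
by transitivity (x.1 * 1 + x.2 * sign 0) => //; rewrite mulr1 sign0 mulr0 addr0.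
Qed.

Lemma homog_ext_var : homog n ext_var.
Proof. by split; [exact: homog_0|rewrite /= subrr; exact: homog_1]. Qed.

Lemma d_ext_var : cdg_d ext_var = ext_const t.
Proof. by apply: ext_eq; rewrite /= ?cdg_d1 // cdg_d0 add0r sign1 mul1r. Qed.

(** The universal property: a map out of the extension is given by a map on
    [R] and a bounding element for the image of t. *)
Lemma ext_lift (S : cdgRingType) (f : cdgHom R S) (v : S) :
  homog n v -> cdg_d v = f t ->
  exists F : cdgHom ext S, forall x, F x = f x.1 + f x.2 * v.
Proof.
move=> Hv dv.
have vC a : v * f a = f (sign a) * v.
  by rewrite (odd_comm _ (od_odd D) Hv) cdgHom_sign.
apply: (build_cdgHom (f := fun x : ext => f x.1 + f x.2 * v)).
- by move=> x y /=; rewrite !rmorphB mulrBl opprD addrACA.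
- split=> [|x y] /=; first by rewrite rmorph1 rmorph0 mul0r addr0.
  rewrite rmorphD !rmorphM !mulrDl !mulrDr -!mulrA vC.
  rewrite [v * (_ * _)]mulrA vC -[_ * v * v]mulrA (odd_square0 (od_odd D) Hv).
  by rewrite !mulr0 addr0 addrA.
- move=> i x [Hx1 Hx2]; apply: homogD; first exact: cdg_fun_deg.
  by rewrite -[i](subrK n); apply: homog_mul => //; exact: cdg_fun_deg.
- move=> x /=; rewrite rmorphD rmorphM !cdg_fun_d cdg_dD cdg_dM dv.
  by rewrite cdgHom_sign addrAC addrA.
Qed.

End Exterior.

(** * Adjoining powers of an even variable *)

(** The powers e_k, of degree k times [ed_deg], multiply by
    e_k e_l = c(k, l) e_(k + l) and satisfy d e_(k + 1) = t e_k. Binomial c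
    gives divided powers; constant c = 1 with t = 0 gives a polynomial variable. The
    field [ed_pascal] is the Leibniz rule for e_(k + 1) e_(l + 1). *)
Record even_datum (R : cdgRingType) := EvenDatum {
  ed_deg : int;
  ed_even : ~~ zodd ed_deg;
  ed_neg : ed_deg <= 0;
  ed_c : nat -> nat -> nat;
  ed_c0 : forall k, ed_c 0 k = 1%N;
  ed_cC : forall k l, ed_c k l = ed_c l k;
  ed_cA : forall k l p,
    (ed_c k l * ed_c (k + l) p = ed_c l p * ed_c k (l + p))%N;
  ed_t : R;
  ed_t_deg : homog (ed_deg + 1) ed_t;
  ed_dt : cdg_d ed_t = 0;
  ed_pascal : forall k l,
    ed_t *+ ed_c k.+1 l.+1 = ed_t *+ (ed_c k l.+1 + ed_c k.+1 l)
}.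

(** The sequence f stands for the sum of the f_k e_k. *)
Record finite_seq (R : cdgRingType) (D : even_datum R) := FSeq {
  coef :> nat -> R;
  coef_fin : exists N, forall k, (N <= k)%N -> coef k = 0
}.

Section FiniteSequences.
Variables (R : cdgRingType) (D : even_datum R).
Local Notation m := (ed_deg D).
Local Notation t := (ed_t D).
Local Notation c := (ed_c D).

Local Notation fseq := (finite_seq D).
Local Notation FSeq := (@FSeq R D).
Implicit Types f g h : fseq.

Lemma fseq_eq f g : coef f =1 coef g -> f = g.
Proof.
case: f g => [f Hf] [g Hg] /= /funext fg; subst g.
by congr FSeq; exact: Prop_irrelevance.
Qed.

HB.instance Definition _ := gen_eqMixin fseq.
HB.instance Definition _ := gen_choiceMixin fseq.

Lemma fseq0_fin : exists N, forall k, (N <= k)%N -> (fun=> 0) k = 0 :> R.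
Proof. by exists 0%N. Qed.
Definition fseq0 := FSeq fseq0_fin.

Lemma fseq_opp_fin f : exists N, forall k, (N <= k)%N -> - f k = 0.
Proof. by have [N f0] := coef_fin f; exists N => k /f0->; rewrite oppr0. Qed.
Definition fseq_opp f := FSeq (fseq_opp_fin f).

Lemma fseq_add_fin f g : exists N, forall k, (N <= k)%N -> f k + g k = 0.
Proof.
have [[N f0] [M g0]] := (coef_fin f, coef_fin g); exists (maxn N M) => k.
by rewrite geq_max => /andP[/f0-> /g0->]; rewrite addr0.
Qed.
Definition fseq_add f g := FSeq (fseq_add_fin f g).

Lemma fseq_addA : associative fseq_add.
Proof. by move=> f g h; apply: fseq_eq => k /=; rewrite addrA. Qed.
Lemma fseq_addC : commutative fseq_add.
Proof. by move=> f g; apply: fseq_eq => k /=; rewrite addrC. Qed.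
Lemma fseq_add0 : left_id fseq0 fseq_add.
Proof. by move=> f; apply: fseq_eq => k /=; rewrite add0r. Qed.
Lemma fseq_addN : left_inverse fseq0 fseq_opp fseq_add.
Proof. by move=> f; apply: fseq_eq => k /=; rewrite addNr. Qed.

HB.instance Definition _ := GRing.isZmodule.Build fseq
  fseq_addA fseq_addC fseq_add0 fseq_addN.

Lemma coef_sum (I : Type) (r : seq I) (F : I -> fseq) k :
  (\sum_(i <- r) F i : fseq) k = \sum_(i <- r) F i k.
Proof. exact: (big_morph (fun f : fseq => f k)). Qed.

Definition mono_coef (n : nat) (a : R) (k : nat) := if k == n then a else 0.
Lemma mono_fin n a : exists N, forall k, (N <= k)%N -> mono_coef n a k = 0.
Proof. by exists n.+1 => k; rewrite /mono_coef; case: eqP => // -> /[!ltnn]. Qed.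
Definition mono n a := FSeq (mono_fin n a).

Lemma monoD n a b : mono n (a + b) = mono n a + mono n b.
Proof.
by apply: fseq_eq => k /=; rewrite /mono_coef; case: eqP; rewrite ?addr0.
Qed.

Lemma monoB n a b : mono n (a - b) = mono n a - mono n b.
Proof.
by apply: fseq_eq => k /=; rewrite /mono_coef; case: eqP; rewrite ?subr0.
Qed.

Lemma mono0 n : mono n 0 = 0.
Proof. by apply: fseq_eq => k /=; rewrite /mono_coef; case: eqP. Qed.

Lemma fseq_sumE f N : (forall k, (N <= k)%N -> f k = 0) ->
  f = \sum_(k < N) mono k (f k).
Proof.
move=> f0; apply: fseq_eq => k; rewrite coef_sum.
rewrite -(big_mkord xpredT (fun i => mono i (f i) k)).
have [kN|Nk] := ltnP k N; last first.
  rewrite big_nat big1 ?f0 // => i /andP[_ iN].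
  by rewrite /= /mono_coef gtn_eqF // (leq_trans iN).
rewrite big_mkord (bigD1 (Ordinal kN)) //= /mono_coef eqxx.
rewrite big1 ?addr0 // => i.
by rewrite -val_eqE /= /= /mono_coef eq_sym => /negPf->.
Qed.

Lemma fseq_split (P : fseq -> Prop) f :
  (forall g h, P g -> P h -> P (g + h)) -> P 0 ->
  (forall k, P (mono k (f k))) -> P f.
Proof.
move=> PD P0 Pm; have [N f0] := coef_fin f; rewrite (fseq_sumE f0).
by elim/big_ind: _ => // i _; exact: Pm.
Qed.

(** All identities below are additive in each variable, so it is enough to
    check them on the terms a e_k; this replaces manipulations of convolutions
    by the formula [mono_mul]. *)
Lemma fseq_ind (P : fseq -> Prop) :
  (forall g h, P g -> P h -> P (g + h)) ->
  (forall k a, P (mono k a)) -> forall f, P f.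
Proof. by move=> PD Pm f; apply: fseq_split => //; rewrite -(mono0 0). Qed.

Definition mul_coef f g n := \sum_(k < n.+1) (f k * g (n - k)%N) *+ c k (n - k).

Lemma mul_fin f g : exists N, forall k, (N <= k)%N -> mul_coef f g k = 0.
Proof.
have [[N f0] [M g0]] := (coef_fin f, coef_fin g); exists (N + M)%N => n Hn.
rewrite /mul_coef big1 // => k _; have [kN|Nk] := ltnP k N.
  by rewrite g0 ?mulr0 ?mul0rn //; lia.
by rewrite f0 // mul0r mul0rn.
Qed.
Definition fseq_mul f g := FSeq (mul_fin f g).

Lemma fseq_mulDl : left_distributive fseq_mul +%R.
Proof.
move=> f g h; apply: fseq_eq => n /=; rewrite /mul_coef -big_split /=.
by apply: eq_bigr => k _; rewrite mulrDl mulrnDl.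
Qed.

Lemma fseq_mulDr : right_distributive fseq_mul +%R.
Proof.
move=> f g h; apply: fseq_eq => n /=; rewrite /mul_coef -big_split /=.
by apply: eq_bigr => k _; rewrite mulrDr mulrnDl.
Qed.

Lemma mono_mul k l a b : fseq_mul (mono k a) (mono l b) =
  mono (k + l) ((a * b) *+ c k l).
Proof.
apply: fseq_eq => n /=; rewrite /mul_coef [RHS]/mono_coef.
have [->|nkl] := eqVneq n (k + l)%N.
  have kn : (k < (k + l).+1)%N by rewrite ltnS leq_addr.
  rewrite (bigD1 (Ordinal kn)) //= /= /mono_coef eqxx addKn eqxx.
  rewrite big1 ?addr0 // => i; rewrite -val_eqE /= => /negPf ik.
  by rewrite /= /mono_coef ik mul0r mul0rn.
rewrite big1 // => i _; rewrite /= /mono_coef.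
case: eqP => [ik|_]; last by rewrite mul0r mul0rn.
case: eqP => [ln|_]; last by rewrite mulr0 mul0rn.
by case/eqP: nkl; rewrite -ln -ik; have := ltn_ord i; lia.
Qed.

Lemma fseq_mulA : associative fseq_mul.
Proof.
apply: fseq_ind => [f f' Hf Hf' g h|k a].
  by rewrite !fseq_mulDl Hf Hf'.
apply: fseq_ind => [g g' Hg Hg' h|l b].
  by rewrite !(fseq_mulDl, fseq_mulDr) Hg Hg'.
apply: fseq_ind => [h h' Hh Hh'|p d].
  by rewrite !fseq_mulDr Hh Hh'.
rewrite !mono_mul addnA; congr mono.
by rewrite mulrnAr mulrnAl -!mulrnA mulrA ed_cA.
Qed.

Lemma fseq_mul1l : left_id (mono 0 1) fseq_mul.
Proof.
apply: fseq_ind => [f g Hf Hg|k a]; first by rewrite fseq_mulDr Hf Hg.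
by rewrite mono_mul mul1r ed_c0.
Qed.

Lemma fseq_mul1r : right_id (mono 0 1) fseq_mul.
Proof.
apply: fseq_ind => [f g Hf Hg|k a]; first by rewrite fseq_mulDl Hf Hg.
by rewrite mono_mul mulr1 addn0 ed_cC ed_c0.
Qed.

HB.instance Definition _ := GRing.Zmodule_isPzRing.Build fseq
  fseq_mulA fseq_mul1l fseq_mul1r fseq_mulDl fseq_mulDr.

Lemma monoM k l a b : mono k a * mono l b = mono (k + l) ((a * b) *+ c k l).
Proof. exact: mono_mul. Qed.

Definition fseq_homog i f := forall k : nat, homog (i - k%:Z * m) (f k).

Lemma fseq_homog0 i : fseq_homog i 0.
Proof. by move=> k; exact: homog_0. Qed.

Lemma fseq_homogB i f g :
  fseq_homog i f -> fseq_homog i g -> fseq_homog i (f - g).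
Proof. by move=> Hf Hg k; apply: homog_sub. Qed.

Lemma fseq_homog_pos (i : int) f : 0 < i -> fseq_homog i f -> f = 0.
Proof.
move=> i_gt0 Hf; apply: fseq_eq => k; apply: homog_pos (Hf k).
by have := ed_neg D; nia.
Qed.

Lemma mono_homog i k a : homog (i - k%:Z * m) a -> fseq_homog i (mono k a).
Proof.
by move=> Ha l; rewrite /= /mono_coef; case: eqP => [->//|_]; exact: homog_0.
Qed.

Lemma fseq_span f : spanned fseq_homog f.
Proof.
move: f; apply: fseq_ind => [f g|k a].
  exact: (spanned_add fseq_homog0 fseq_homogB).
move: a; apply: homog_ind => [a b Ha Hb|i a Ha].
  by rewrite monoD; exact: (spanned_add fseq_homog0 fseq_homogB).
apply: (spanned_homog fseq_homog0 fseq_homog_pos (i := i + k%:Z * m)).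
by apply: mono_homog; rewrite addrK.
Qed.

Lemma fseq_direct (N : nat) (x : nat -> fseq) :
  (forall k, fseq_homog (- k%:Z) (x k)) -> \sum_(k < N) x k = 0 ->
  forall k, (k < N)%N -> x k = 0.
Proof.
move=> Hx x0 k kN; apply: fseq_eq => l.
apply: (homog_inj_sum (s := - (l%:Z * m)) (c := fun k => x k l)) kN => [p|].
  by rewrite addrC; exact: Hx.
by rewrite -coef_sum x0.
Qed.

Lemma fseq_homog1 : fseq_homog 0 1.
Proof. by apply: mono_homog; rewrite mul0r subr0; exact: homog_1. Qed.

Lemma fseq_homogM i j f g :
  fseq_homog i f -> fseq_homog j g -> fseq_homog (i + j) (f * g).
Proof.
move=> Hf Hg n; apply: homog_sum => k; apply: homogMn.
have -> : i + j - n%:Z * m = (i - k%:Z * m) + (j - (n - k)%N%:Z * m).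
  have kn : (k <= n)%N by rewrite -ltnS.
  rewrite -subzn // mulrBl !opprB; lia.
exact: homog_mul.
Qed.

Lemma zodd_coef i (k : nat) : zodd (i - k%:Z * m) = zodd i.
Proof. by rewrite zoddD zoddN zoddMn (negPf (ed_even D)) andbF addbF. Qed.

Lemma fseq_gcomm i j f g : fseq_homog i f -> fseq_homog j g ->
  g * f = (-1) ^+ (`|i| * `|j|)%N * (f * g).
Proof.
move=> Hf Hg; rewrite -signr_odd oddM.
apply: (@fseq_split (fun x => g * x = (-1) ^+ _ * (x * g)) f) => [f1 f2||k].
- by rewrite !(mulrDl, mulrDr) => -> ->.
- by rewrite mulr0 mul0r mulr0.
apply: (@fseq_split (fun x => x * _ = (-1) ^+ _ * (_ * x)) g) => [g1 g2||l].
- by rewrite !(mulrDl, mulrDr) => -> ->.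
- by rewrite mul0r mulr0 mulr0.
rewrite mulr_sign !monoM (gcommE (Hf k) (Hg l)) !zodd_coef /zodd addnC ed_cC.
by case: ifP => // _; rewrite mulNrn -sub0r monoB mono0 sub0r.
Qed.

Lemma fseq_sq0 i f : odd `|i|%N -> fseq_homog i f -> f * f = 0.
Proof.
move=> iO Hf; suff [] : fseq_homog i f /\ f * f = 0 by [].
apply: (@fseq_split (fun x => fseq_homog i x /\ x * x = 0))
  => [g h [Hg g2] [Hh h2]||k].
- split; first exact: (closed_add fseq_homog0 fseq_homogB).
  rewrite mulrDl !mulrDr g2 h2 add0r addr0 (fseq_gcomm Hg Hh).
  by rewrite -signr_odd oddM iO mulN1r subrr.
- by split; [exact: fseq_homog0|rewrite mulr0].
- split; first exact: mono_homog.
  rewrite monoM (odd_square0 _ (Hf k)) ?mul0rn ?mono0 //.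
  by rewrite -/(zodd _) zodd_coef.
Qed.

HB.instance Definition _ := PzRing_isCommGraded.Build fseq
  fseq_homog0 fseq_homogB fseq_homog_pos fseq_span fseq_direct fseq_homog1
  fseq_homogM fseq_gcomm fseq_sq0.

(** The coefficient of e_k in d f: since t is odd,
    d (a e_(k + 1)) = d a e_(k + 1) + sign a t e_k. *)
Definition d_coef f k := cdg_d (f k) + sign (f k.+1) * t.
Lemma d_fin f : exists N, forall k, (N <= k)%N -> d_coef f k = 0.
Proof.
have [N f0] := coef_fin f; exists N => k Nk.
by rewrite /d_coef !f0 // ?cdg_d0 ?sign0 ?mul0r ?addr0 // ltnW.
Qed.
Definition fseq_d f := FSeq (d_fin f).

Lemma fseq_dD : {morph fseq_d : f g / f + g}.
Proof.
move=> f g; apply: fseq_eq => k /=; rewrite /d_coef /= cdg_dD signD mulrDl.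
by rewrite addrACA.
Qed.

Lemma fseq_d_deg i f : homog i f -> homog (i + 1) (fseq_d f).
Proof.
move=> Hf k; apply: homogD; first by rewrite addrAC; apply: cdg_d_deg.
have -> : i + 1 - k%:Z * m = (i - k.+1%:Z * m) + (m + 1).
  by rewrite -addn1 PoszD mulrDl mul1r; lia.
by apply: homog_mul (homog_sign (Hf k.+1)) (ed_t_deg D).
Qed.

Lemma ed_t_odd : zodd (m + 1).
Proof. by rewrite zoddD (negPf (ed_even D)). Qed.

Lemma fseq_dd f : fseq_d (fseq_d f) = 0.
Proof.
apply: fseq_eq => k /=; rewrite /d_coef /= /d_coef cdg_dD cdg_dd add0r cdg_dM.
rewrite ed_dt mulr0 addr0 signD signM (sign_odd ed_t_odd (ed_t_deg D)) signK.
rewrite mulrDl -mulrA mulNr (odd_square0 ed_t_odd (ed_t_deg D)) oppr0 mulr0.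
by rewrite addr0 cdg_d_sign mulNr addNr.
Qed.

Lemma sign_fin f : exists N, forall k, (N <= k)%N -> sign (f k) = 0.
Proof. by have [N f0] := coef_fin f; exists N => k /f0->; rewrite sign0. Qed.
Definition fseq_sign f := FSeq (sign_fin f).

Lemma fseq_sign_mono k a : fseq_sign (mono k a) = mono k (sign a).
Proof.
apply: fseq_eq => l /=; rewrite /mono_coef; case: eqP => // _; exact: sign0.
Qed.

Definition lower k a := if k is l.+1 then mono l a else 0.

Lemma fseq_d_mono k a :
  fseq_d (mono k a) = mono k (cdg_d a) + lower k (sign a * t).
Proof.
apply: fseq_eq => l /=; rewrite /d_coef /= /mono_coef; congr (_ + _).
  by case: eqP => // _; exact: cdg_d0.
case: k => [|k] /=; first by rewrite sign0 mul0r.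
by rewrite eqSS /= /mono_coef; case: eqP; rewrite // sign0 mul0r.
Qed.

(** The sign involution of the extension acts on coefficients because the
    e_k are even; the interior terms are matched by [ed_pascal]. *)
Lemma fseq_dM f g : fseq_d (f * g) = fseq_d f * g + fseq_sign f * fseq_d g.
Proof.
have fseq_signD : {morph fseq_sign : x y / x + y}.
  by move=> x y; apply: fseq_eq => k /=; rewrite signD.
elim/fseq_ind: f => [f f'|k a].
  move=> Hf Hf'; rewrite fseq_signD !(mulrDl, fseq_dD) Hf Hf'.
  by rewrite addrACA.
elim/fseq_ind: g => [g g'|l b].
  move=> Hg Hg'; rewrite !(mulrDr, fseq_dD) Hg Hg'.
  by rewrite addrACA.
have tC x : t * x = sign x * t by exact: odd_comm ed_t_odd (ed_t_deg D).
have dMn x n : cdg_d (x *+ n) = cdg_d x *+ n :> R by rewrite raddfMn.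
have sMn (x : R) n : sign (x *+ n) = sign x *+ n by rewrite raddfMn.
rewrite fseq_sign_mono monoM !fseq_d_mono mulrDl mulrDr !monoM.
rewrite dMn cdg_dM mulrnDl monoD -!addrA; congr (_ + _).
rewrite [RHS]addrCA; congr (_ + _).
rewrite sMn signM mulrnAl.
case: k => [|k] /=; case: l => [|l] /=; rewrite ?mul0r ?mulr0 ?addr0 ?add0r //.
- by rewrite monoM !ed_c0 mulrA.
- rewrite !addn0 monoM addn0 !(ed_cC D _ 0) !ed_c0.
  by rewrite !mulr1n -!mulrA tC.
- rewrite !monoM addSn -addnS -monoD; congr mono.
  rewrite -mulrnAr ed_pascal mulrnDr mulrDr !mulrnAr.
  by rewrite -[sign a * t * b]mulrA tC !mulrA.
Qed.

Lemma fseq_leibniz i j f g : homog i f -> homog j g ->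
  fseq_d (f * g) = fseq_d f * g + (-1) ^+ `|i|%N * (f * fseq_d g).
Proof.
move=> Hf _; rewrite fseq_dM -signr_odd mulr_sign -/(zodd i).
have -> : fseq_sign f = if zodd i then - f else f.
  apply: fseq_eq => k /=; rewrite (signE (Hf k)) zodd_coef.
  by case: ifP.
by case: ifP; rewrite // mulNr.
Qed.

HB.instance Definition _ := CommGraded_isCDG.Build fseq
  fseq_dD fseq_d_deg fseq_dd fseq_leibniz.

Lemma coef_sign f k : sign f k = sign (f k).
Proof.
elim/homog_ind: f => [f g Hf Hg|i f Hf].
  rewrite signD; transitivity (sign f k + sign g k) => //.
  by rewrite Hf Hg -signD.
by rewrite (signE Hf) (signE (Hf k)) zodd_coef; case: ifP.
Qed.

Lemma fseq_const_hom : exists F : cdgHom R fseq, F =1 mono 0.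
Proof.
apply: build_cdgHom.
- exact: monoB.
- by split=> // a b; rewrite monoM ed_c0.
- by move=> i a Ha; apply: mono_homog; rewrite mul0r subr0.
- by move=> a; transitivity (fseq_d (mono 0 a)) => //; rewrite fseq_d_mono addr0.
Qed.

Definition fseq_var k : fseq := mono k 1.

Lemma homog_fseq_var k : homog (k%:Z * m) (fseq_var k).
Proof. by apply: mono_homog; rewrite subrr; exact: homog_1. Qed.

Lemma fseq_varM k l : fseq_var k * fseq_var l = fseq_var (k + l) *+ c k l.
Proof.
rewrite monoM mulr1 /fseq_var; elim: (c k l) => [|n IHn]; first exact: mono0.
by rewrite !mulrSr monoD IHn.
Qed.

Lemma d_fseq_var k : cdg_d (fseq_var k.+1) = mono 0 t * fseq_var k.
Proof.
transitivity (fseq_d (fseq_var k.+1)) => //.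
by rewrite fseq_d_mono cdg_d1 mono0 add0r monoM ed_c0 sign1 mul1r mulr1.
Qed.

(** The universal property: a map out of the extension is given by a map on
    [R] and elements x_k satisfying the relations of the e_k. *)
Section Lift.
Variables (S : cdgRingType) (phi : cdgHom R S) (x : nat -> S).
Hypotheses (x_deg : forall k, homog (k%:Z * m) (x k)) (x0 : x 0 = 1).
Hypothesis xM : forall k l, x k * x l = x (k + l) *+ c k l.
Hypothesis dx : forall k, cdg_d (x k.+1) = phi t * x k.

Lemma fseq_lift : exists F : cdgHom fseq S,
  forall k a, F (mono k a) = phi a * x k.
Proof.
pose F f := \sum_(k < sval (cid (coef_fin f))) phi (f k) * x k.
have FE f N : (forall k, (N <= k)%N -> f k = 0) ->
    F f = \sum_(k < N) phi (f k) * x k.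
  move=> f0; rewrite /F; move: (svalP (cid (coef_fin f))).
  move: (sval _) => M /= f0'.
  pose G k := phi (f k) * x k.
  have G0 n : f n = 0 -> G n = 0 by move=> fn; rewrite /G fn rmorph0 mul0r.
  rewrite (sum_widen (F := G) (leq_maxl M N)) => [|k /f0' /G0 //].
  by rewrite (sum_widen (F := G) (leq_maxr M N)) => [|k /f0 /G0 //].
have FB : zmod_morphism F.
  move=> f g; have [[N f0] [M g0]] := (coef_fin f, coef_fin g).
  have f0' k : (maxn N M <= k)%N -> f k = 0 by rewrite geq_max => /andP[/f0].
  have g0' k : (maxn N M <= k)%N -> g k = 0 by rewrite geq_max => /andP[_ /g0].
  rewrite (FE _ _ f0') (FE _ _ g0') (FE _ (maxn N M)) => [|k Hk].
    by rewrite -sumrB; apply: eq_bigr => k _; rewrite /= rmorphB mulrBl.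
  by rewrite /= f0' // g0' // subr0.
have Fm k a : F (mono k a) = phi a * x k.
  rewrite (FE _ k.+1) => [|l]; last first.
    by rewrite /= /mono_coef; case: eqP => // -> /[!ltnn].
  rewrite big_ord_recr /= /= /mono_coef eqxx big1 ?add0r // => l _.
  by rewrite /= /mono_coef ltn_eqF // rmorph0 mul0r.
have FD := morphBD FB.
have xC k a : x k * a = a * x k.
  apply: even_central (x_deg k).
  by rewrite zoddMn (negPf (ed_even D)) andbF.
have FM : monoid_morphism F.
  split; first by rewrite Fm rmorph1 mul1r.
  apply: fseq_ind => [f f' Hf Hf' g|k a].
    by rewrite mulrDl !FD Hf Hf' mulrDl.
  apply: fseq_ind => [g g' Hg Hg'|l b].
    by rewrite mulrDr !FD Hg Hg' mulrDr.
  rewrite monoM !Fm rmorphMn rmorphM mulrA -[phi a * x k * phi b]mulrA xC.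
  by rewrite !mulrA -[_ * x k * x l]mulrA xM mulrnAl mulrnAr.
have Fdeg i f : homog i f -> homog i (F f).
  move=> Hf; have [N f0] := coef_fin f; rewrite (FE _ _ f0).
  apply: homog_sum => k; rewrite -[i](subrK (k%:Z * m)).
  by apply: homog_mul => //; apply: cdg_fun_deg; exact: Hf.
have Fd f : F (cdg_d f) = cdg_d (F f).
  elim/fseq_ind: f => [f g Hf Hg|k a]; first by rewrite cdg_dD !FD cdg_dD Hf Hg.
  transitivity (F (fseq_d (mono k a))) => //.
  rewrite fseq_d_mono FD !Fm cdg_dM cdg_fun_d; congr (_ + _).
  case: k => [|k] /=; first by rewrite x0 cdg_d1 mulr0 (morphB0 FB).
  by rewrite Fm rmorphM cdgHom_sign dx mulrA.
have [F' F'E] := build_cdgHom FB FM Fdeg Fd.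
by exists F' => k a; rewrite F'E Fm.
Qed.

End Lift.
End FiniteSequences.

(** * Adjoining one variable and its differential *)

(** The possible values of (gamma^k x), for a variable x of degree [i]. For odd
    [i] only x itself matters, and the remaining values are normalized to 0 so
    that both parities can be treated together. *)
Definition admissible (R : cdgRingType) (i : int) (x : nat -> R) : Prop :=
  if zodd i then homog i (x 1%N) /\ (forall k, k != 1%N -> x k = 0)
  else [/\ forall k, homog (k%:Z * i) (x k), x 0%N = 1,
           forall k l, x k * x l = x (k + l)%N *+ 'C(k + l, l)
         & forall k, cdg_d (x k.+1) = cdg_d (x 1%N) * x k].

(** The powers of the zero element, which is where an augmentation sends x. *)
Definition trivial_powers (R : cdgRingType) (i : int) (k : nat) : R :=
  if (k == 0%N) && ~~ zodd i then 1 else 0.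

Lemma admissible_trivial (R : cdgRingType) (i : int) :
  admissible i (@trivial_powers R i).
Proof.
rewrite /admissible /trivial_powers; case: (boolP (zodd i)) => iO.
  by split=> [|k _]; rewrite ?andbF //; exact: homog_0.
split=> // [k|k l|k]; rewrite ?andbT.
- by case: eqP => [->|_]; rewrite ?mul0r; [exact: homog_1|exact: homog_0].
- rewrite addn_eq0; case: k => [|k] /=; last by rewrite mul0r mul0rn.
  by case: l => [|l] /=; rewrite ?mulr0 ?mul0rn // mulr1.
- by rewrite !cdg_d0 mul0r.
Qed.

Lemma admissible_hom (R S : cdgRingType) (f : cdgHom R S) i (x : nat -> R) :
  admissible i x -> admissible i (fun k => f (x k)).
Proof.
rewrite /admissible; case: ifP => _.
  move=> [Hx x0]; split; first exact: cdg_fun_deg.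
  by move=> k /x0->; rewrite rmorph0.
move=> [Hx x0 xM dx]; split=> [k||k l|k].
- exact: cdg_fun_deg.
- by rewrite x0 rmorph1.
- by rewrite -rmorphM xM rmorphMn.
- by rewrite -!cdg_fun_d dx rmorphM.
Qed.

Lemma admissible_deg (R : cdgRingType) i (x : nat -> R) :
  admissible i x -> forall k, homog (k%:Z * i) (x k).
Proof.
rewrite /admissible; case: ifP => _ [] // Hx x0 k.
by have [->|/x0->] := eqVneq k 1%N; rewrite ?mul1r //; exact: homog_0.
Qed.

Lemma trivial_powers_hom (R S : cdgRingType) (f : cdgHom R S) i k :
  f (trivial_powers R i k) = trivial_powers S i k.
Proof. by rewrite /trivial_powers; case: ifP; rewrite ?rmorph1 ?rmorph0. Qed.

(** [C] is [R] with a variable (the family [y]) of degree [i] and its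
    differential adjoined: it maps to [R] with arbitrary values of the variable,
    and it has the same cohomology as [R]. *)
Definition contractible_ext (R : cdgRingType) (i : int) (C : cdgRingType) :=
  exists (const : cdgHom R C) (aug : cdgHom C R) (y : nat -> C),
  [/\ admissible i y,
      (forall a, aug (const a) = a) /\
      (forall k, aug (y k) = trivial_powers R i k),
      forall x, admissible i x -> exists F : cdgHom C R,
        (forall a, F (const a) = a) /\ (forall k, F (y k) = x k)
    & forall z, cdg_d z = 0 -> exists w, z - const (aug z) = cdg_d w].

(** Both sides are (k + l + p)! / (k! l! p!). *)
Lemma multinomial_assoc k l p :
  ('C(k + l, k) * 'C(k + l + p, k + l) =
   'C(l + p, l) * 'C(k + (l + p), k))%N.
Proof.
have binE a b : ('C(a + b, a) * (a`! * b`!) = (a + b)`!)%N.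
  by rewrite -{2}(addKn a b) bin_fact ?leq_addr.
apply/eqP; rewrite -(eqn_pmul2r (m := (k`! * l`! * p`!)%N));
  last by rewrite !muln_gt0 !fact_gt0.
apply/eqP; transitivity ((k + l + p)`!).
  by rewrite -binE -[in RHS](binE k l); nia.
by rewrite -addnA -binE -[in LHS](binE l p); nia.
Qed.

(** For even [i], first adjoin u = dx with d u = 0, then the divided powers
    e_k of x with d e_(k + 1) = u e_k. *)
Section EvenExtension.
Variables (R : cdgRingType) (i : int).
Hypotheses (i_even : ~~ zodd i) (i_neg : i < 0).

Lemma even_i1_odd : zodd (i + 1).
Proof. by rewrite zoddD (negPf i_even). Qed.

Lemma even_i1_neg : i + 1 < 0.
Proof. by move: i_even i_neg; rewrite /zodd; lia. Qed.

Definition dx_datum : odd_datum R :=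
  OddDatum even_i1_odd even_i1_neg (homog_0 _) (@cdg_d0 R).

Lemma dx_cycle : cdg_d (ext_var dx_datum) = 0.
Proof. by rewrite d_ext_var. Qed.

Lemma dx_pascal k l : ext_var dx_datum *+ 'C(k.+1 + l.+1, k.+1) =
  ext_var dx_datum *+ ('C(k + l.+1, k) + 'C(k.+1 + l, k.+1)).
Proof. by rewrite addSn binS addnC -addSnnS. Qed.

Lemma bin_sym k l : 'C(k + l, k) = 'C(l + k, l).
Proof. by rewrite -bin_sub ?leq_addr // addKn addnC. Qed.

Definition powers_datum : even_datum (exterior dx_datum) :=
  EvenDatum i_even (ltW i_neg) (fun k => bin0 (0 + k)) bin_sym
    multinomial_assoc (homog_ext_var dx_datum) dx_cycle dx_pascal.

(** The contraction sends b u e_k to sign b e_(k + 1), and a e_k to 0. *)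
Lemma even_extension : contractible_ext R i (finite_seq powers_datum).
Proof.
have [c1 c1E] := ext_const_hom dx_datum.
have [c2 c2E] := fseq_const_hom powers_datum.
have [const constE] := cdgHom_comp c2 c1.
have [idR idRE] := cdgHom_id R.
have lift x : admissible i x -> exists F : cdgHom (finite_seq powers_datum) R,
    forall k (a : exterior dx_datum),
      F (mono powers_datum k a) = (a.1 + a.2 * cdg_d (x 1%N)) * x k.
  rewrite /admissible (negPf i_even) => -[x_deg x0 xM dx].
  have dx1 : homog (i + 1) (cdg_d (x 1%N)).
    by apply: cdg_d_deg; have := x_deg 1%N; rewrite mul1r.
  have ddx1 : cdg_d (cdg_d (x 1%N)) = idR 0 by rewrite cdg_dd rmorph0.
  have [phi phiE] := @ext_lift _ dx_datum _ idR _ dx1 ddx1.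
  have dx' k : cdg_d (x k.+1) = phi (ext_var dx_datum) * x k.
    by rewrite phiE !idRE add0r mul1r dx.
  have [k l|F FE] := @fseq_lift _ powers_datum _ phi x x_deg x0 _ dx'.
    by rewrite xM /= (bin_sym k l) (addnC l k).
  by exists F => k a; rewrite FE phiE !idRE.
have [aug augE] := lift _ (admissible_trivial R i).
have trivE k : trivial_powers R i k = (k == 0%N)%:R.
  by rewrite /trivial_powers i_even andbT; case: eqP.
have augE' z : aug z = (z 0%N).1.
  elim/fseq_ind: z => [f g Hf Hg|k a]; first by rewrite rmorphD Hf Hg.
  rewrite augE !trivE /= cdg_d0 mulr0 addr0 /mono_coef.
  by case: k => [|k]; rewrite ?mulr1 ?mulr0.
exists const, aug, (fseq_var powers_datum); split.
- rewrite /admissible (negPf i_even); split=> // [k|k l|k].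
  + exact: homog_fseq_var.
  + by rewrite fseq_varM /= bin_sym addnC.
  + by rewrite !d_fseq_var mulr1.
- split=> [a|k]; first by rewrite augE' constE c1E c2E.
  by rewrite augE trivE /= mul0r addr0 mul1r trivE.
- move=> x Hx; have [F FE] := lift x Hx; exists F; split=> [a|k].
    rewrite constE c1E c2E FE /= mul0r addr0.
    move: Hx; rewrite /admissible (negPf i_even) => -[_ -> _ _].
    by rewrite mulr1.
  by rewrite FE /= mul0r addr0 mul1r.
- move=> z dz.
  pose w k : exterior dx_datum := if k is l.+1 then (sign (z l).2, 0) else 0.
  have w_fin : exists N, forall k, (N <= k)%N -> w k = 0.
    have [N z0] := coef_fin z; exists N.+1 => -[//|k] /z0 zk.
    by apply: ext_eq; rewrite /= ?zk ?sign0.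
  exists (FSeq powers_datum w_fin); apply: fseq_eq => k.
  have dzk l : d_coef z l = 0 by rewrite -[LHS]/(cdg_d z l) dz.
  have zS l : cdg_d (sign (z l).2) = (z l.+1).1.
    have /(congr1 snd) := dzk l.
    rewrite /d_coef ext_mul_var ext_signE /= => dzl.
    by rewrite cdg_d_sign -signN (addr0_eq dzl) signK.
  rewrite augE' constE c1E c2E.
  transitivity (d_coef (FSeq powers_datum w_fin) k) => //.
  rewrite /d_coef /= /mono_coef ext_mul_var ext_signE.
  case: k => [|k]; apply: ext_eq => /=.
  - by rewrite subrr cdg_d0 sign0 mul0r !addr0.
  - by rewrite subr0 cdg_d0 add0r signK.
  - by rewrite subr0 zS sign0 mul0r !addr0.
  - by rewrite subr0 cdg_d0 add0r signK.
Qed.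

End EvenExtension.

(** For odd [i], first adjoin a polynomial variable y = dx with d y = 0, then an
    exterior variable x with d x = y. *)
Section OddExtension.
Variables (R : cdgRingType) (i : int).
Hypotheses (i_odd : zodd i) (i_neg : i < 0).

Lemma odd_i1_even : ~~ zodd (i + 1).
Proof. by rewrite zoddD i_odd. Qed.

Lemma odd_i1_le0 : i + 1 <= 0.
Proof. by move: i_neg; lia. Qed.

Lemma pascal0 k l : (0 : R) *+ (fun _ _ => 1%N) k.+1 l.+1 = 0 *+ (1 + 1).
Proof. by rewrite !mul0rn. Qed.

Definition dx_powers_datum : even_datum R :=
  @EvenDatum R _ odd_i1_even odd_i1_le0 (fun _ _ => 1%N) (fun=> erefl)
    (fun _ _ => erefl) (fun _ _ _ => erefl) 0 (homog_0 _) (@cdg_d0 R) pascal0.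

Local Notation y1 := (fseq_var dx_powers_datum 1).

Lemma homog_y1 : homog (i + 1) y1.
Proof. by have := homog_fseq_var dx_powers_datum 1; rewrite mul1r. Qed.

Lemma y1_cycle : cdg_d y1 = 0.
Proof. by rewrite d_fseq_var mono0 mul0r. Qed.

Definition x_datum : odd_datum (finite_seq dx_powers_datum) :=
  OddDatum i_odd i_neg homog_y1 y1_cycle.

Lemma coef_mul_y1 (f : finite_seq dx_powers_datum) k :
  mul_coef f y1 k = if k is l.+1 then f l else 0.
Proof.
rewrite -[LHS]/((f * y1) k).
elim/fseq_ind: f => [f g Hf Hg|l a].
  rewrite mulrDl; transitivity ((f * y1) k + (g * y1) k) => //.
  by rewrite Hf Hg; case: k {Hf Hg} => //; rewrite addr0.
rewrite monoM mulr1 addn1 /= /mono_coef.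
by case: k => [|k].
Qed.

(** The contraction sends a y^(k + 1) to sign a y^k x, and a and b y^k x
    to 0. *)
Lemma odd_extension : contractible_ext R i (exterior x_datum).
Proof.
have [c1 c1E] := fseq_const_hom dx_powers_datum.
have [c2 c2E] := ext_const_hom x_datum.
have [const constE] := cdgHom_comp c2 c1.
have [idR idRE] := cdgHom_id R.
have lift x : admissible i x -> exists F : cdgHom (exterior x_datum) R,
    forall k a l b, F (mono dx_powers_datum k a, mono dx_powers_datum l b) =
      a * cdg_d (x 1%N) ^+ k + b * cdg_d (x 1%N) ^+ l * x 1%N.
  rewrite /admissible i_odd => -[x1_deg _].
  have dx1 : homog (i + 1) (cdg_d (x 1%N)) by exact: cdg_d_deg.
  have p_deg (k : nat) : homog (k%:Z * (i + 1)) (cdg_d (x 1%N) ^+ k).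
    elim: k => [|k IHk]; first by rewrite mul0r; exact: homog_1.
    by rewrite exprS -addn1 addnC PoszD mulrDl mul1r; exact: homog_mul.
  have pM k l : cdg_d (x 1%N) ^+ k * cdg_d (x 1%N) ^+ l =
      cdg_d (x 1%N) ^+ (k + l) *+ 1 by rewrite exprD.
  have dp k : cdg_d (cdg_d (x 1%N) ^+ k.+1) = idR 0 * cdg_d (x 1%N) ^+ k.
    rewrite rmorph0 mul0r; elim: k.+1 => [|l IHl]; first exact: cdg_d1.
    by rewrite exprS cdg_dM IHl cdg_dd mul0r mulr0 addr0.
  have [phi phiE] := @fseq_lift _ dx_powers_datum _ idR
    (fun k => cdg_d (x 1%N) ^+ k) p_deg erefl pM dp.
  have dx' : cdg_d (x 1%N) = phi y1 by rewrite phiE idRE mul1r expr1.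
  have [F FE] := @ext_lift _ x_datum _ phi _ x1_deg dx'.
  by exists F => k a l b; rewrite FE !phiE !idRE.
have [aug augE] := lift _ (admissible_trivial R i).
have trivE k : trivial_powers R i k = 0 by rewrite /trivial_powers i_odd andbF.
have augE' z : aug z = z.1 0%N.
  have zE : z = (z.1, mono _ 0 0) + (mono _ 0 0, z.2).
    by apply: ext_eq; rewrite /= mono0 ?addr0 ?add0r.
  rewrite [in LHS]zE rmorphD; have -> : aug (z.1, mono _ 0 0) = z.1 0%N.
    elim/fseq_ind: (z.1) => [f g Hf Hg|k a].
      have -> : ((f + g, mono _ 0 0) : exterior x_datum) =
          (f, mono _ 0 0) + (g, mono _ 0 0).
        by apply: ext_eq; rewrite /= ?mono0 ?addr0.
      by rewrite rmorphD Hf Hg.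
    rewrite augE !trivE cdg_d0 mulr0 addr0 /= /mono_coef.
    by case: k => [|k]; rewrite ?expr0 ?mulr1 // expr0n mulr0.
  suff -> : aug (mono _ 0 0, z.2) = 0 by rewrite addr0.
  elim/fseq_ind: (z.2) => [f g Hf Hg|k a].
    have -> : ((mono _ 0 0, f + g) : exterior x_datum) =
        (mono _ 0 0, f) + (mono _ 0 0, g).
      by apply: ext_eq; rewrite /= ?mono0 ?addr0.
    by rewrite rmorphD Hf Hg addr0.
  by rewrite augE !trivE mul0r mulr0 addr0.
exists const, aug, (fun k => if k == 1%N then ext_var x_datum else 0); split.
- rewrite /admissible i_odd; split=> [|k /negPf->//]; exact: homog_ext_var.
- split=> [a|k]; first by rewrite augE' constE c1E c2E.
  by rewrite trivE augE'; case: eqP.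
- move=> x Hx; have [F FE] := lift x Hx; exists F; split=> [a|k].
    by rewrite constE c1E c2E /ext_const -(mono0 _ 0) FE mulr1 !mul0r addr0.
  move: Hx; rewrite /admissible i_odd => -[_ x0].
  have [->|/x0->] := eqVneq k 1%N; last exact: rmorph0.
  by rewrite /ext_var -(mono0 _ 0) FE mul0r add0r !mul1r.
- move=> z dz.
  pose w k := sign (z.1 k.+1).
  have w_fin : exists N, forall k, (N <= k)%N -> w k = 0.
    have [N z0] := coef_fin z.1; exists N => k Nk.
    by rewrite /w z0 ?sign0 // ltnW.
  exists (0, FSeq dx_powers_datum w_fin).
  have dz1 k : cdg_d (z.1 k.+1) + sign (z.2 k) = 0.
    have : (ext_d z).1 k.+1 = 0 by rewrite -[ext_d z]/(cdg_d z) dz.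
    rewrite /ext_d -[od_t _]/y1 /= coef_mul_y1 coef_sign /d_coef /=.
    by rewrite mulr0 addr0.
  rewrite augE' constE c1E c2E.
  transitivity
    (ext_d ((0, FSeq dx_powers_datum w_fin) : exterior x_datum)) => //.
  apply: ext_eq => /=; apply: fseq_eq => k.
    rewrite cdg_d0 add0r /= coef_mul_y1 /= /mono_coef.
    by case: k => [|k]; rewrite /= ?subrr // subr0 coef_sign signK.
  rewrite /= /d_coef /= mulr0 addr0 subr0 /w cdg_d_sign -signN.
  by rewrite (addr0_eq (dz1 k)) signK.
Qed.

End OddExtension.

Lemma contractible_extension (R : cdgRingType) (i : int) : i < 0 ->
  exists C : cdgRingType, contractible_ext R i C.
Proof.
move=> i_neg; case: (boolP (zodd i)) => iO; eexists.
  exact: (odd_extension R iO i_neg).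
exact: (even_extension R iO i_neg).
Qed.

(** * The free extension by a family of variables *)

(** Expressions in constants of [A] and the symbols gamma^k(g) for g in [G];
    negation is expressed as multiplication by the constant -1. *)
Inductive term (A G : Type) : Type :=
  | Base of A
  | Gen of G & nat
  | Add of term A G & term A G
  | Mul of term A G & term A G
  | Diff of term A G.

Arguments Base {A G}.
Arguments Gen {A G}.

HB.instance Definition _ (A G : Type) := gen_eqMixin (term A G).
HB.instance Definition _ (A G : Type) := gen_choiceMixin (term A G).

Record model (A : cdgRingType) (G : Type) (deg : G -> int) := Model {
  carrier :> cdgRingType;
  base : cdgHom A carrier;
  gens : G -> nat -> carrier;
  gens_admissible : forall g, admissible (deg g) (gens g)
}.

Section FreeExtension.
Variables (A : cdgRingType) (G : Type) (deg : G -> int).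
Local Notation term := (term A G).
Local Notation model := (model A deg).

Fixpoint eval (M : model) (s : term) : M :=
  match s with
  | Base a => base M a
  | Gen g k => gens M g k
  | Add s1 s2 => eval M s1 + eval M s2
  | Mul s1 s2 => eval M s1 * eval M s2
  | Diff s1 => cdg_d (eval M s1)
  end.

(** Equality in all models quantifies over all CDG rings over [A]; being a
    proposition it stays in the universe of [A], so the quotient is again a CDG
    ring of the same kind, and in particular the target of models itself. *)
Definition term_equiv : rel term :=
  fun s1 s2 => `[< forall M, eval M s1 = eval M s2 >].

Lemma term_equiv_equiv : equiv_class_of term_equiv.
Proof.
split=> [s|s1 s2|s2 s1 s3].
- by apply/asboolP.
- by apply/asboolP/asboolP=> H M.
- move=> /asboolP H12 /asboolP H23; apply/asboolP => M.
  by rewrite H12.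
Qed.

Canonical term_equiv_rel := EquivRelPack term_equiv_equiv.

Definition free_cdg := {eq_quot term_equiv}.

HB.instance Definition _ := Choice.on free_cdg.

Definition ev (M : model) (x : free_cdg) : M := eval M (repr x).

Definition cls (s : term) : free_cdg := \pi_({eq_quot term_equiv}) s.

Lemma ev_cls M s : ev M (cls s) = eval M s.
Proof.
rewrite /ev; have /eqmodP/asboolP := reprK (cls s); exact.
Qed.

(** Models separate points, so every identity that holds in all CDG rings is
    inherited by the quotient. *)
Lemma free_eq (x y : free_cdg) : (forall M, ev M x = ev M y) -> x = y.
Proof.
move=> H; rewrite -[x]reprK -[y]reprK; apply/eqmodP/asboolP; exact: H.
Qed.

Definition free_add (x y : free_cdg) : free_cdg := cls (Add (repr x) (repr y)).
Definition free_mul (x y : free_cdg) : free_cdg := cls (Mul (repr x) (repr y)).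
Definition free_opp (x : free_cdg) : free_cdg := cls (Mul (Base (- 1)) (repr x)).
Definition free_zero := cls (Base 0).
Definition free_one := cls (Base 1).
Definition free_d (x : free_cdg) : free_cdg := cls (Diff (repr x)).

Lemma ev_add M x y : ev M (free_add x y) = ev M x + ev M y.
Proof. by rewrite ev_cls. Qed.
Lemma ev_mul M x y : ev M (free_mul x y) = ev M x * ev M y.
Proof. by rewrite ev_cls. Qed.
Lemma ev_opp M x : ev M (free_opp x) = - ev M x.
Proof. by rewrite ev_cls /= rmorphN1 mulN1r. Qed.
Lemma ev_zero M : ev M free_zero = 0.
Proof. by rewrite ev_cls /= rmorph0. Qed.
Lemma ev_one M : ev M free_one = 1.
Proof. by rewrite ev_cls /= rmorph1. Qed.
Lemma ev_d M x : ev M (free_d x) = cdg_d (ev M x).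
Proof. by rewrite ev_cls. Qed.

Definition evE := (ev_add, ev_mul, ev_opp, ev_zero, ev_one, ev_d).

Lemma free_addA : associative free_add.
Proof. by move=> x y z; apply: free_eq => M; rewrite !evE addrA. Qed.
Lemma free_addC : commutative free_add.
Proof. by move=> x y; apply: free_eq => M; rewrite !evE addrC. Qed.
Lemma free_add0 : left_id free_zero free_add.
Proof. by move=> x; apply: free_eq => M; rewrite !evE add0r. Qed.
Lemma free_addN : left_inverse free_zero free_opp free_add.
Proof. by move=> x; apply: free_eq => M; rewrite !evE addNr. Qed.

HB.instance Definition _ := GRing.isZmodule.Build free_cdg
  free_addA free_addC free_add0 free_addN.

Lemma free_mulA : associative free_mul.
Proof. by move=> x y z; apply: free_eq => M; rewrite !evE mulrA. Qed.
Lemma free_mul1l : left_id free_one free_mul.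
Proof. by move=> x; apply: free_eq => M; rewrite !evE mul1r. Qed.
Lemma free_mul1r : right_id free_one free_mul.
Proof. by move=> x; apply: free_eq => M; rewrite !evE mulr1. Qed.
Lemma free_mulDl : left_distributive free_mul free_add.
Proof. by move=> x y z; apply: free_eq => M; rewrite !evE mulrDl. Qed.
Lemma free_mulDr : right_distributive free_mul free_add.
Proof. by move=> x y z; apply: free_eq => M; rewrite !evE mulrDr. Qed.

HB.instance Definition _ := GRing.Zmodule_isPzRing.Build free_cdg
  free_mulA free_mul1l free_mul1r free_mulDl free_mulDr.

Lemma evD M : {morph ev M : x y / x + y}. Proof. exact: ev_add. Qed.
Lemma ev0 M : ev M 0 = 0. Proof. exact: ev_zero. Qed.
Lemma evN M : {morph ev M : x / - x}. Proof. exact: ev_opp. Qed.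
Lemma evB M : {morph ev M : x y / x - y}.
Proof. by move=> x y; rewrite evD evN. Qed.
Lemma ev1 M : ev M 1 = 1. Proof. exact: ev_one. Qed.
Lemma evM M : {morph ev M : x y / x * y}. Proof. exact: ev_mul. Qed.
Lemma ev_sum M (I : Type) (r : seq I) (F : I -> free_cdg) :
  ev M (\sum_(i <- r) F i) = \sum_(i <- r) ev M (F i).
Proof. exact: (big_morph _ (evD M) (ev0 M)). Qed.
Lemma ev_signM M (n : nat) x : ev M ((-1) ^+ n * x) = (-1) ^+ n * ev M x.
Proof.
rewrite -(signr_odd free_cdg) -(signr_odd M) !mulr_sign.
by case: odd; rewrite ?evN.
Qed.

Definition free_homog i (x : free_cdg) := forall M, homog i (ev M x).

Lemma free_homog0 i : free_homog i 0.
Proof. by move=> M; rewrite ev0; exact: homog_0. Qed.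

Lemma free_homogB i x y :
  free_homog i x -> free_homog i y -> free_homog i (x - y).
Proof. by move=> Hx Hy M; rewrite evB; exact: homog_sub (Hx M) (Hy M). Qed.

Lemma free_homog_pos (i : int) x : 0 < i -> free_homog i x -> x = 0.
Proof.
move=> i_gt0 Hx; apply: free_eq => M.
by rewrite ev0; exact: homog_pos (Hx M).
Qed.

Lemma free_homogM i j x y :
  free_homog i x -> free_homog j y -> free_homog (i + j) (x * y).
Proof. by move=> Hx Hy M; rewrite evM; exact: homog_mul (Hx M) (Hy M). Qed.

Lemma free_dD : {morph free_d : x y / x + y}.
Proof. by move=> x y; apply: free_eq => M; rewrite !(evE, evD) cdg_dD. Qed.

Lemma free_d_deg i x : free_homog i x -> free_homog (i + 1) (free_d x).
Proof. by move=> Hx M; rewrite ev_d; apply: cdg_d_deg; exact: Hx. Qed.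

Definition free_base a := cls (Base a).
Definition free_gen g k := cls (Gen g k).

Lemma ev_base M a : ev M (free_base a) = base M a.
Proof. exact: ev_cls. Qed.
Lemma ev_gen M g k : ev M (free_gen g k) = gens M g k.
Proof. exact: ev_cls. Qed.

Lemma free_ind (P : free_cdg -> Prop) :
  (forall a, P (free_base a)) -> (forall g k, P (free_gen g k)) ->
  (forall x y, P x -> P y -> P (x + y)) ->
  (forall x y, P x -> P y -> P (x * y)) ->
  (forall x, P x -> P (free_d x)) -> forall x, P x.
Proof.
move=> Pb Pg PD PM Pd x; rewrite -[x]reprK -/(cls _); elim: (repr x) => //.
- move=> s1 H1 s2 H2; suff -> : cls (Add s1 s2) = cls s1 + cls s2 by exact: PD.
  by apply: free_eq => M; rewrite evD !ev_cls.
- move=> s1 H1 s2 H2; suff -> : cls (Mul s1 s2) = cls s1 * cls s2 by exact: PM.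
  by apply: free_eq => M; rewrite evM !ev_cls.
- move=> s H; suff -> : cls (Diff s) = free_d (cls s) by exact: Pd.
  by apply: free_eq => M; rewrite ev_d !ev_cls.
Qed.

(** The one axiom that is not an identity: by induction on expressions, since
    constants are sums of homogeneous ones and every symbol is homogeneous. *)
Lemma free_span x : spanned free_homog x.
Proof.
have add := spanned_add free_homog0 free_homogB.
have hom := spanned_homog free_homog0 free_homog_pos.
have sum := spanned_sum free_homog0 free_homogB.
elim/free_ind: x => [a|g k|x y|x y|x].
- elim/homog_ind: a => [a b Ha Hb|i a Ha].
    suff -> : free_base (a + b) = free_base a + free_base b by exact: add.
    by apply: free_eq => M; rewrite evD !ev_base rmorphD.
  by apply: (hom i) => M; rewrite ev_base; exact: cdg_fun_deg.
- apply: (hom (k%:Z * deg g)) => M; rewrite ev_gen.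
  exact: admissible_deg (gens_admissible M g) k.
- exact: add.
- exact: (spanned_mul free_homog0 free_homogB free_homog_pos free_homogM).
- move=> [n [c [Hc ->]]].
  have d0 : free_d 0 = 0 by apply: free_eq => M; rewrite ev_d ev0 cdg_d0.
  rewrite (big_morph _ free_dD d0); apply: sum => k.
  exact: hom (free_d_deg (Hc k)).
Qed.

Lemma free_direct (n : nat) (c : nat -> free_cdg) :
  (forall k, free_homog (- k%:Z) (c k)) -> \sum_(k < n) c k = 0 ->
  forall k, (k < n)%N -> c k = 0.
Proof.
move=> Hc c0 k kn; apply: free_eq => M; rewrite ev0.
apply: (@homog_direct M n (fun k => ev M (c k))) kn => [l|]; first exact: Hc.
by rewrite -ev_sum c0 ev0.
Qed.

Lemma free_homog1 : free_homog 0 1.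
Proof. by move=> M; rewrite ev1; exact: homog_1. Qed.

Lemma free_gcomm i j x y : free_homog i x -> free_homog j y ->
  y * x = (-1) ^+ (`|i| * `|j|)%N * (x * y).
Proof.
move=> Hx Hy; apply: free_eq => M; rewrite ev_signM !evM.
exact: gcommutative.
Qed.

Lemma free_sq0 i x : odd `|i|%N -> free_homog i x -> x * x = 0.
Proof.
move=> iO Hx; apply: free_eq => M; rewrite evM ev0; exact: odd_square0 (Hx M).
Qed.

HB.instance Definition _ := PzRing_isCommGraded.Build free_cdg
  free_homog0 free_homogB free_homog_pos free_span free_direct free_homog1
  free_homogM free_gcomm free_sq0.

Lemma free_dd x : free_d (free_d x) = 0.
Proof. by apply: free_eq => M; rewrite !ev_d ev0 cdg_dd. Qed.

Lemma free_leibniz i j x y : homog i x -> homog j y ->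
  free_d (x * y) = free_d x * y + (-1) ^+ `|i|%N * (x * free_d y).
Proof.
move=> Hx Hy; apply: free_eq => M; rewrite evD ev_signM !evM !ev_d evM.
exact: cdg_leibniz (Hx M) (Hy M).
Qed.

HB.instance Definition _ := CommGraded_isCDG.Build free_cdg
  free_dD free_d_deg free_dd free_leibniz.

Lemma free_eval_hom (M : model) : exists F : cdgHom free_cdg M,
  (forall a, F (free_base a) = base M a) /\
  (forall g k, F (free_gen g k) = gens M g k).
Proof.
have [||||F FE] := @build_cdgHom free_cdg M (ev M).
- exact: evB.
- by split; [exact: ev1|exact: evM].
- by move=> i x; exact.
- exact: ev_d.
by exists F; split=> *; rewrite FE ?ev_base ?ev_gen.
Qed.

Lemma free_base_hom : exists F : cdgHom A free_cdg, F =1 free_base.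
Proof.
apply: build_cdgHom.
- by move=> a b; apply: free_eq => M; rewrite evB !ev_base rmorphB.
- split=> [|a b]; apply: free_eq => M; first by [].
  by rewrite evM !ev_base rmorphM.
- by move=> i a Ha M; rewrite ev_base; exact: cdg_fun_deg.
- by move=> a; apply: free_eq => M; rewrite ev_d !ev_base cdg_fun_d.
Qed.

(** The symbols themselves satisfy the relations of divided powers, so the free
    extension is one of its own models. *)
Lemma free_gen_admissible g : admissible (deg g) (free_gen g).
Proof.
have adm (M : model) := gens_admissible M g.
rewrite /admissible in adm *; case: (zodd (deg g)) adm => /= adm.
  split=> [M|k k1]; first by rewrite ev_gen; have [] := adm M.
  by apply: free_eq => M; rewrite ev_gen ev0; have [_ ->] := adm M.
split=> [k M||k l|k].
- by rewrite ev_gen; have [] := adm M.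
- by apply: free_eq => M; rewrite ev_gen ev1; have [_ ->] := adm M.
- apply: free_eq => M; have [_ _ xM _] := adm M; rewrite evM !ev_gen xM.
  by elim: 'C(_, _) => [|n IHn]; rewrite ?ev0 // !mulrS evD IHn ev_gen.
- apply: free_eq => M; have [_ _ _ dx] := adm M.
  by rewrite evM !ev_d !ev_gen.
Qed.

Lemma free_hom_ext (S : cdgRingType) (F F' : cdgHom free_cdg S) :
  (forall a, F (free_base a) = F' (free_base a)) ->
  (forall g k, F (free_gen g k) = F' (free_gen g k)) -> F =1 F'.
Proof.
move=> Hb Hg; apply: free_ind => // [x y Hx Hy|x y Hx Hy|x Hx].
- by rewrite !rmorphD Hx Hy.
- by rewrite !rmorphM Hx Hy.
- by rewrite -[free_d x]/(cdg_d x) !cdg_fun_d Hx.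
Qed.

End FreeExtension.

(** * Contracting the free extension *)

Section Contraction.
Variables (A : cdgRingType) (G : eqType) (deg : G -> int).
Hypothesis deg_neg : forall g, deg g < 0.
Local Notation free_cdg := (@free_cdg A G deg).
Local Notation free_base := (@free_base A G deg).
Local Notation free_gen := (@free_gen A G deg).

(** With [C] obtained from the free extension by adjoining one more variable of
    the degree of [g0], let [Phi] map [g0] to this variable and every other
    symbol to itself, and let [F] map the variable back to [g0]. Then [F] undoes
    [Phi], and applying [F] to the contraction of [Phi z] bounds the difference
    between [z] and its image under the augmentation after [Phi], which is the
    map that kills [g0]. *)
Lemma kill_generator g0 : exists rho : cdgHom free_cdg free_cdg,
  [/\ forall a, rho (free_base a) = free_base a,
      forall g k, rho (free_gen g k) =
        if g == g0 then trivial_powers free_cdg (deg g) k else free_gen g k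
    & forall z, cdg_d z = 0 -> exists w, z - rho z = cdg_d w].
Proof.
have [C [const [aug [y [y_adm [augC augY] lift contr]]]]] :=
  contractible_extension free_cdg (deg_neg g0).
have [b bE] := free_base_hom A deg.
have [cb cbE] := cdgHom_comp const b.
pose gen g k := if g == g0 then y k else const (free_gen g k).
have gen_adm g : admissible (deg g) (gen g).
  rewrite /gen; case: eqP => [->//|_].
  exact: (admissible_hom const (free_gen_admissible A deg g)).
have [Phi [PhiB PhiG]] := free_eval_hom (Model cb gen_adm).
rewrite /= in Phi PhiB PhiG.
have [rho rhoE] := cdgHom_comp aug Phi.
have [F [FC FY]] := lift _ (free_gen_admissible A deg g0).
have FPhi z : F (Phi z) = z.
  have [FP FPE] := cdgHom_comp F Phi; have [idf idfE] := cdgHom_id free_cdg.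
  rewrite -FPE -[RHS]idfE; apply: free_hom_ext => [a|g k]; rewrite FPE idfE.
    by rewrite PhiB cbE FC bE.
  by rewrite PhiG /gen; case: eqP => [->|_]; rewrite ?FY ?FC.
exists rho; split=> [a|g k|z dz].
- by rewrite rhoE PhiB cbE augC bE.
- by rewrite rhoE PhiG /gen; case: eqP => [->|_]; rewrite ?augY ?augC.
- have dPhi : cdg_d (Phi z) = 0 by rewrite -cdg_fun_d dz rmorph0.
  have [w wE] := contr _ dPhi; exists (F w).
  by rewrite -cdg_fun_d -wE rmorphB FPhi FC rhoE.
Qed.

(** Killing the finitely many symbols that occur in an expression leaves its
    value under the retraction; each step changes a cocycle by a
    coboundary. *)
Lemma free_retraction : exists p : cdgHom free_cdg A,
  (forall a, p (free_base a) = a) /\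
  (forall z, cdg_d z = 0 -> exists w, z - free_base (p z) = cdg_d w).
Proof.
have [idA idAE] := cdgHom_id A.
have [p [pB pG]] :=
  free_eval_hom (Model idA (fun g => admissible_trivial A (deg g))).
rewrite /= in p pB pG.
have [b bE] := free_base_hom A deg.
exists p; split=> [a|z dz]; first by rewrite pB idAE.
pose rho g := sval (cid (kill_generator g)).
have rhoB g a : rho g (free_base a) = free_base a.
  by have [] := svalP (cid (kill_generator g)).
have rhoG g g' k : rho g (free_gen g' k) =
    if g' == g then trivial_powers free_cdg (deg g') k else free_gen g' k.
  by have [] := svalP (cid (kill_generator g)).
have rhoH g x : cdg_d x = 0 -> exists w, x - rho g x = cdg_d w.
  by have [_ _] := svalP (cid (kill_generator g)); exact.
pose kill L x := foldr (fun g => rho g) x L.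
have killD L : {morph kill L : x y / x + y}.
  by move=> x y; elim: L => //= g L ->; rewrite rmorphD.
have killM L : {morph kill L : x y / x * y}.
  by move=> x y; elim: L => //= g L ->; rewrite rmorphM.
have killd L x : kill L (cdg_d x) = cdg_d (kill L x).
  by elim: L => //= g L ->; rewrite cdg_fun_d.
have killH L : exists w, z - kill L z = cdg_d w.
  elim: L => [|g L [w IHL]] /=; first by exists 0; rewrite subrr cdg_d0.
  have [|w' w'E] := rhoH g (kill L z).
    by rewrite -killd dz; elim: L {IHL} => //= ? ? ->; rewrite rmorph0.
  by exists (w + w'); rewrite cdg_dD -IHL -w'E addrA subrK.
have killB L a : kill L (free_base a) = free_base a by elim: L => //= g L ->.
have kill_all x : exists L : seq G, forall L' : seq G,
    {subset L <= L'} -> kill L' x = b (p x).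
  move: x; apply: free_ind => [a|g k|x y|x y|x].
  - by exists [::] => L' _; rewrite killB pB idAE bE.
  - exists [:: g] => L' gL'; have {gL'} : g \in L' by exact: gL' (mem_head _ _).
    rewrite pG; elim: L' => //= g' L' IHL'; rewrite inE.
    have [gL'|gL'] := boolP (g \in L'); first by rewrite IHL' // bE rhoB.
    rewrite orbF => /eqP <-; have -> : kill L' (free_gen g k) = free_gen g k.
      elim: L' gL' {IHL'} => //= h L' IHL'.
      rewrite inE negb_or => /andP[gh gL'].
      by rewrite IHL' // rhoG (negPf gh).
    by rewrite rhoG eqxx trivial_powers_hom.
  - move=> [L1 H1] [L2 H2]; exists (L1 ++ L2) => L' sL.
    rewrite killD H1 ?H2 ?rmorphD // => g gL; apply: sL; rewrite mem_cat gL //.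
    by rewrite orbT.
  - move=> [L1 H1] [L2 H2]; exists (L1 ++ L2) => L' sL.
    rewrite killM H1 ?H2 ?rmorphM // => g gL; apply: sL; rewrite mem_cat gL //.
    by rewrite orbT.
  - move=> [L HL]; exists L => L' sL; rewrite -[free_d x]/(cdg_d x).
    by rewrite killd HL // !cdg_fun_d.
have [L killE] := kill_all z; have [w wE] := killH L; exists w.
by rewrite -wE killE // bE.
Qed.

End Contraction.

(** * The resolution of the given quasi-isomorphism *)

Section NegativeElements.
Variables (B : cdgRingType) (gamma : pdStructure B).

(** The degree is part of the index, as the element 0 does not determine it. *)
Definition neg_elements :=
  {ib : (int * B)%type | `[< ib.1 < 0 /\ homog ib.1 ib.2 >]}.

Definition neg_deg (g : neg_elements) : int := (val g).1.

Lemma neg_degP g : neg_deg g < 0.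
Proof. by case: g => ib Hib; case/asboolP: (Hib). Qed.

Definition neg_powers (g : neg_elements) (k : nat) : B :=
  if zodd (neg_deg g) then if k == 1%N then (val g).2 else 0
  else pd_gamma gamma (neg_deg g) k (val g).2.

Lemma neg_powers1 g : neg_powers g 1 = (val g).2.
Proof.
case: g => -[i b] Hib; case/asboolP: (Hib) => /= i_neg Hb.
rewrite /neg_powers /neg_deg /=; case: (boolP (zodd i)) => // iE.
by apply: pd_gamma1 => //; split=> //; move: iE i_neg; rewrite /zodd; lia.
Qed.

Lemma neg_powers_admissible g : admissible (neg_deg g) (neg_powers g).
Proof.
case: g => -[i b] Hib; case/asboolP: (Hib) => /= i_neg Hb.
rewrite /admissible /neg_powers /neg_deg /=; case: (boolP (zodd i)) => iE.
  by split=> // k /negPf->.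
have iP : pd_degree i by split=> //; move: iE i_neg; rewrite /zodd; lia.
split=> [k||k l|k].
- exact: pd_gamma_deg.
- exact: pd_gamma0.
- exact: pd_gammaM.
- by rewrite (pd_gamma_d gamma iP Hb) // (pd_gamma1 gamma iP Hb).
Qed.

End NegativeElements.

Lemma quasi_iso_surj (A B : cdgRingType) (f : cdgHom A B) : quasi_iso f ->
  forall b, cdg_d b = 0 -> exists a b', cdg_d a = 0 /\ b = f a + cdg_d b'.
Proof.
move=> [g fK gK] b db.
have bZ : b \in @cocycle B by rewrite inE db.
have := gK (\pi_(cohomology B) (Cocycle bZ)).
set x := g _; rewrite -[x]reprK cohomology_map_pi => /eqP.
rewrite eq_sym -Quotient.idealrBE => /asboolP[b' /= bE].
exists (repr x), b'; split; first by case: (repr x) => a /= /eqP.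
by rewrite -bE addrC subrK.
Qed.

(** On cohomology, [p] and [e] are mutually inverse, so [g] is the composite of
    [p] and [f]. *)
Lemma quasi_iso_retract (A R B : cdgRingType) (f : cdgHom A B)
    (e : cdgHom A R) (p : cdgHom R A) (g : cdgHom R B) :
  quasi_iso f -> (forall a, p (e a) = a) -> (forall a, g (e a) = f a) ->
  (forall z, cdg_d z = 0 -> exists w, z - e (p z) = cdg_d w) -> quasi_iso g.
Proof.
move=> [h fK hK] pe ge pH.
have class_eq (S : cdgRingType) (x y : cocycles S) w :
    cocycle_val x - cocycle_val y = cdg_d w ->
    \pi_(cohomology S) x = \pi_(cohomology S) y.
  move=> xy; apply/eqP; rewrite -Quotient.idealrBE; apply/asboolP.
  by exists w; rewrite -xy raddfB.
have cycle (S : cdgRingType) (z : cocycles S) : cdg_d (cocycle_val z) = 0.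
  by case: z => z /= /eqP.
have rep (S : cdgRingType) (x : cohomology S) :
    exists z, x = \pi_(cohomology S) z.
  by exists (repr x); rewrite reprK.
have gp x : cohomology_map g x = cohomology_map f (cohomology_map p x).
  have [z ->] := rep _ x; rewrite !cohomology_map_pi.
  have [w wE] := pH _ (cycle _ z); apply: (class_eq _ _ _ (g w)) => /=.
  by rewrite -cdg_fun_d -wE rmorphB ge.
have ep x : cohomology_map e (cohomology_map p x) = x.
  have [z ->] := rep _ x; rewrite !cohomology_map_pi.
  have [w wE] := pH _ (cycle _ z); apply: (class_eq _ _ _ (- w)) => /=.
  by rewrite cdg_dN -wE opprB.
have pe' x : cohomology_map p (cohomology_map e x) = x.
  have [z ->] := rep _ x; rewrite !cohomology_map_pi.
  by apply: (class_eq _ _ _ 0) => /=; rewrite pe subrr cdg_d0.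
exists (fun y => cohomology_map e (h y)) => [x|y].
  by rewrite gp fK ep.
by rewrite gp pe' hK.
Qed.

Theorem theorem1 (A B : cdgRingType) (f : cdgHom A B)
    (hf : quasi_iso f) (hB : inhabited (pdStructure B)) :
  exists (Bt : cdgRingType) (e : cdgHom A Bt) (p : cdgHom Bt A)
      (ft : cdgHom Bt B),
    [/\ forall a : A, p (e a) = a,
        forall a : A, ft (e a) = f a,
        forall b : B, exists b' : Bt, ft b' = b &
        quasi_iso ft].
Proof.
case: hB => gamma.
have [e eE] := free_base_hom A (@neg_deg B).
have [p [pe pH]] := free_retraction A (@neg_degP B).
have [ft [ftB ftG]] := free_eval_hom (Model f (neg_powers_admissible gamma)).
rewrite /= in ft ftB ftG.
exists (free_cdg A (@neg_deg B)), e, p, ft.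
have ftE a : ft (e a) = f a by rewrite eE ftB.
have sur_neg (i : int) (b : B) : i < 0 -> homog i b -> exists b', ft b' = b.
  move=> i_neg Hb; have Hib : `[< (i, b).1 < 0 /\ homog (i, b).1 (i, b).2 >].
    exact/asboolP.
  exists (free_gen A (@neg_deg B) (exist _ (i, b) Hib) 1).
  by rewrite ftG neg_powers1.
have surD b1 b2 : (exists b', ft b' = b1) -> (exists b', ft b' = b2) ->
    exists b', ft b' = b1 + b2.
  by move=> [x <-] [y <-]; exists (x + y); rewrite rmorphD.
have d_deg0 (b : B) : homog 0 b -> cdg_d b = 0.
  by move=> Hb; apply: (@homog_pos B (0 + 1)) => //; exact: cdg_d_deg.
(* Only components of negative degree contribute to a coboundary, since
   elements of degree 0 are cocycles. *)
have sur_d b : exists b', ft b' = cdg_d b.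
  elim/homog_ind: b => [b1 b2 H1 H2|i b Hb]; first by rewrite cdg_dD; exact: surD.
  have [i_neg|i_pos|i0] := ltgtP i 0.
  - have [b' <-] := sur_neg i b i_neg Hb.
    by exists (cdg_d b'); rewrite cdg_fun_d.
  - by exists 0; rewrite (homog_pos i_pos Hb) cdg_d0 rmorph0.
  - by exists 0; rewrite rmorph0 d_deg0 // -i0.
have pe' a : p (e a) = a by rewrite eE pe.
split=> // [b|].
- elim/homog_ind: b => [b1 b2 H1 H2|i b Hb]; first exact: surD.
  have [i_neg|i_pos|i0] := ltgtP i 0; first exact: sur_neg Hb.
    by exists 0; rewrite (homog_pos i_pos Hb) rmorph0.
  have [|a [b' [_ ->]]] := quasi_iso_surj hf (b := b).
    by apply: d_deg0; rewrite -i0.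
  by apply: surD (sur_d b'); exists (e a).
- apply: (quasi_iso_retract hf pe' ftE) => z /pH[w wE].
  by exists w; rewrite eE.
Qed.
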